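(* Let $T$ be a theory of continuous first order logic, let $\varphi(x,y)$ be a formula which is stable in $T$, let $M$ be a model of $T$ and let $p\in \mathrm S_\varphi(M)$. Then there is a family of parameters $C\subseteq M$ (indexed like $X$) such that $d\varphi(y,C)=d_p\varphi(y)$ (so in particular, a definition $d_p\varphi$ of $p$ exists). Moreover, $d_p\varphi$ is an $M$-definable $\tilde\varphi$-predicate.
   Context: **Continuous logic.** Truth values lie in $[0,1]$, $0$ meaning true. A (metric, possibly many-sorted) continuous signature $\mathcal L$ consists of function and predicate symbols of finite arities, a distinguished binary predicate symbol $d$ on each sort, and for each symbol and each argument a uniform continuity modulus. An $\mathcal L$-structure interprets function symbols by functions and predicate symbols by $[0,1]$-valued functions, with $d$ a complete metric and each symbol respecting its moduli in each argument. Formulae are built from atomic ones using the connectives $\neg x=1-x$, $x/2$, $x\dot- y=\max(x-y,0)$ and the quantifiers $\sup,\inf$. A condition is $\varphi=0$; a theory (not necessarily complete) is a set of conditions without free variables. Finite tuples of variables are treated as single variables. **Stability.** $\varphi(x,y)$ is $\varepsilon$-stable ($\varepsilon>0$) if in no model of $T$ is there an infinite sequence $(a_i,b_i)_{i<\omega}$ with $|\varphi(a_i,b_j)-\varphi(a_j,b_i)|\ge\varepsilon$ for all $i<j$; it is stable if $\varepsilon$-stable for all $\varepsilon>0$. Write $\tilde\varphi(y,x)=\varphi(x,y)$. **Types and predicates.** $\mathrm S_x(M)$ is the space of complete types over $M$ in the variable $x$ (sets of conditions with parameters in $M$ satisfied by some element of an elementary extension of $M$), with the coarsest topology making $p\mapsto\psi^p$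 continuous for every formula $\psi(x)$ with parameters in $M$, where $\psi^p$ is the value of $\psi$ at a realisation of $p$. $\mathrm S_\varphi(M)$ is the quotient space of $\mathrm S_x(M)$ identifying two types when they give the same value to $\varphi(x,b)$ for every $b\in M$. An $M$-definable predicate $\psi(y)$ is a continuous function $\mathrm S_y(M)\to[0,1]$ (equivalently a uniform limit of formulae with parameters in $M$); it is evaluated at $b$ in an elementary extension of $M$ through $\mathrm{tp}(b/M)$, and predicates are equal when they agree on all such $b$. An $M$-definable $\tilde\varphi$-predicate is a continuous function $\mathrm S_{\tilde\varphi}(M)\to[0,1]$, viewed as an $M$-definable predicate in $y$ via $\mathrm S_y(M)\to\mathrm S_{\tilde\varphi}(M)$. A definition of $p\in\mathrm S_\varphi(M)$ is an $M$-definable predicate $\psi(y)$ such that $\varphi(x,b)^p=\psi(b)$ for all $b\in M$; it is unique if it exists and is denoted $d_p\varphi(y)$. **The predicate $d\varphi$.** For a sequence $(a_n)_{n<\omega}$ in $[0,1]$ put $a_{*,0}=a_0$ and let $a_{*,n+1}$ be the point of $[a_{*,n}-2^{-n-1},a_{*,n}+2^{-n-1}]$ closest to $a_{n+1}$; the forced limit is $\mathrm{flim}_n a_n=\lim_n a_{*,n}$. For $\varphi$ stable, $N(\varphi,\varepsilon)$ is the least $N$ such that in no model of $T$ is there a sequence $(a_i,b_i)_{i<N+1}$ with $|\varphi(a_j,b_i)-\varphi(a_j,b_k)|\ge\varepsilon$ for all $i<j<k$ (such $N$ exists). Let $\mathrm{med}_n(t_0,\dots,t_{2n-2})=\min_{w}\max_{i\in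 w}t_i$, $w$ ranging over $n$-element subsets of $\{0,\dots,2n-2\}$ (the median), and $d^\varepsilon\varphi(y,x_{<2N(\varphi,\varepsilon)-1})=\mathrm{med}_{N(\varphi,\varepsilon)}(\varphi(x_i,y):i<2N(\varphi,\varepsilon)-1)$. Finally $X=(x^n_i: n<\omega,\ i<2N(\varphi,2^{-n})-1)$ and $d\varphi(y,X)=\mathrm{flim}_n\, d^{2^{-n}}\varphi(y,x^n_{<2N(\varphi,2^{-n})-1})$. *)

(* Defs.v *)
From HB Require Import structures.
From mathcomp Require Import all_boot all_order all_algebra.
From mathcomp Require Import all_classical all_reals all_analysis.
Import Order.TTheory GRing.Theory Num.Theory.
Import numFieldNormedType.Exports.

Set Implicit Arguments.
Unset Strict Implicit.
Unset Printing Implicit Defensive.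

Local Open Scope classical_set_scope.
Local Open Scope ring_scope.

(** * Signatures *)

Record modulus (R : realType) := Modulus {
  delta :> R -> R;
  delta_gt0 : forall e, 0 < e -> 0 < delta e }.

(* [rsym] collects the predicate symbols other than the distances. *)
Record symbols := Symbols {
  sorts : Type;
  fsym : Type;
  farity : fsym -> nat;
  fdom : forall f, 'I_(farity f) -> sorts;
  fcod : fsym -> sorts;
  rsym : Type;
  rarity : rsym -> nat;
  rdom : forall P, 'I_(rarity P) -> sorts }.
Arguments fdom {s} f i.
Arguments rdom {s} P i.

Inductive psym (S : symbols) := Dist of sorts S | Rel of rsym S.

Definition parity (S : symbols) (P : psym S) : nat :=
  match P with Dist _ => 2 | Rel P => rarity P end.

Definition pdom (S : symbols) (P : psym S) : 'I_(parity P) -> sorts S :=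
  match P with Dist s => fun=> s | Rel P => rdom P end.
Arguments pdom {S} P i.

Record signature (R : realType) := Signature {
  syms :> symbols;
  fmod : forall f : fsym syms, 'I_(farity f) -> modulus R;
  pmod : forall P : psym syms, 'I_(parity P) -> modulus R }.
Arguments fmod {R s} f i.
Arguments pmod {R s} P i.

(** * Contexts of sorted variables *)

Record ctx (S : symbols) := Ctx { var : Type; vsort : var -> sorts S }.
Arguments vsort {S} c v.

Definition tuple_ctx (S : symbols) n (s : 'I_n -> sorts S) : ctx S :=
  @Ctx S 'I_n s.

Definition empty_ctx (S : symbols) : ctx S :=
  @Ctx S void (fun v => match v with end).

Definition cat_ctx (S : symbols) (X Y : ctx S) : ctx S :=
  @Ctx S (var X + var Y)%type
    (fun v => match v with inl v => vsort X v | inr w => vsort Y w end).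

Definition snoc_ctx (S : symbols) (X : ctx S) (s : sorts S) : ctx S :=
  @Ctx S (option (var X)) (fun v => if v is Some v then vsort X v else s).

(** * Terms and formulae *)

Inductive term (S : symbols) (X : ctx S) : sorts S -> Type :=
| Var (v : var X) : term X (vsort X v)
| App (f : fsym S) (t : forall i, term X (fdom f i)) : term X (fcod f).
Arguments Var {S} X v.

Inductive formula (S : symbols) (X : ctx S) : Type :=
| Atom (P : psym S) (t : forall i, term X (pdom P i))
| Neg (phi : formula X)
| Half (phi : formula X)
| Monus (phi psi : formula X)
| Sup (s : sorts S) (phi : formula (snoc_ctx X s))
| Inf (s : sorts S) (phi : formula (snoc_ctx X s)).

Definition subst_map (S : symbols) (X Y : ctx S) : Type :=
  forall v : var X, term Y (vsort X v).

Fixpoint tsubst (S : symbols) (X Y : ctx S) (h : subst_map X Y) s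
    (t : term X s) : term Y s :=
  match t with
  | Var v => h v
  | App f t => App (fun i => tsubst h (t i))
  end.

Definition lift_subst (S : symbols) (X Y : ctx S) (h : subst_map X Y) s :
    subst_map (snoc_ctx X s) (snoc_ctx Y s) :=
  fun v => match v return term (snoc_ctx Y s) (vsort (snoc_ctx X s) v) with
  | Some v => tsubst (fun w => Var (snoc_ctx Y s) (Some w)) (h v)
  | None => Var (snoc_ctx Y s) None
  end.

Fixpoint fsubst (S : symbols) (X Y : ctx S) (h : subst_map X Y)
    (phi : formula X) : formula Y :=
  match phi with
  | Atom P t => Atom (fun i => tsubst h (t i))
  | Neg phi => Neg (fsubst h phi)
  | Half phi => Half (fsubst h phi)
  | Monus phi psi => Monus (fsubst h phi) (fsubst h psi)
  | Sup s phi => Sup (fsubst (@lift_subst S X Y h s) phi)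
  | Inf s phi => Inf (fsubst (@lift_subst S X Y h s) phi)
  end.

Definition tilde (S : symbols) (X Y : ctx S) (phi : formula (cat_ctx X Y)) :
    formula (cat_ctx Y X) :=
  fsubst (fun v => match v return term _ (vsort (cat_ctx X Y) v) with
                   | inl v => Var (cat_ctx Y X) (inr v)
                   | inr w => Var (cat_ctx Y X) (inl w)
                   end) phi.

(** * Structures *)

Record prestructure (R : realType) (S : symbols) := Prestructure {
  carrier :> sorts S -> Type;
  ifun : forall f : fsym S, (forall i, carrier (fdom f i)) -> carrier (fcod f);
  ipred : forall P : psym S, (forall i, carrier (pdom P i)) -> R }.
Arguments ifun {R S} p f a.
Arguments ipred {R S} p P a.

Definition dist (R : realType) (S : symbols) (M : prestructure R S) (s : sorts S)
    (a b : M s) : R :=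
  ipred M (Dist s) (fun i : 'I_2 => if val i is 0%N then a else b).

(* Sorts are nonempty, as usual in first order logic. *)
Record structure (R : realType) (L : signature R) := Structure {
  pre :> prestructure R L;
  carrier_inhabited : forall s, inhabited (pre s);
  ipred_bounds : forall P (a : forall i, pre (pdom P i)),
    0 <= ipred pre P a <= 1;
  dist_eq0 : forall s (a b : pre s), dist a b = 0 <-> a = b;
  dist_sym : forall s (a b : pre s), dist a b = dist b a;
  dist_triangle : forall s (a b c : pre s), dist a c <= dist a b + dist b c;
  dist_complete : forall s (u : nat -> pre s),
    (forall e : R, 0 < e -> exists n, forall i j,
       (n <= i)%N -> (n <= j)%N -> dist (u i) (u j) < e) ->
    exists l, (fun i => dist (u i) l) @ \oo --> (0 : R);
  ifun_unif : forall f (i : 'I_(farity f)) (a b : forall i, pre (fdom f i)),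
    (forall j, j != i -> a j = b j) ->
    forall e : R, 0 < e -> dist (a i) (b i) < fmod f i e ->
    dist (ifun pre f a) (ifun pre f b) <= e;
  ipred_unif : forall P (i : 'I_(parity P)) (a b : forall i, pre (pdom P i)),
    (forall j, j != i -> a j = b j) ->
    forall e : R, 0 < e -> dist (a i) (b i) < pmod P i e ->
    `|ipred pre P a - ipred pre P b| <= e }.

Section Semantics.
Variables (R : realType) (L : signature R).
Implicit Types (X Y : ctx L) (M N : structure L).

Definition valuation M X : Type := forall v : var X, M (vsort X v).

Definition vcat M X Y (a : valuation M X) (b : valuation M Y) :
    valuation M (cat_ctx X Y) :=
  fun v => match v return M (vsort (cat_ctx X Y) v) with
  | inl v => a v | inr w => b w end.

Definition vsnoc M X s (a : valuation M X) (c : M s) :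
    valuation M (snoc_ctx X s) :=
  fun v => match v return M (vsort (snoc_ctx X s) v) with
  | Some v => a v | None => c end.

Definition vempty M : valuation M (empty_ctx L) :=
  fun v => match v with end.

Fixpoint teval M X (a : valuation M X) s (t : term X s) : M s :=
  match t with
  | Var v => a v
  | App f t => ifun M f (fun i => teval a (t i))
  end.

Fixpoint feval M X (phi : formula X) : valuation M X -> R :=
  match phi with
  | Atom P t => fun a => ipred M P (fun i => teval a (t i))
  | Neg phi => fun a => 1 - feval phi a
  | Half phi => fun a => feval phi a / 2
  | Monus phi psi => fun a => Num.max (feval phi a - feval psi a) 0
  | Sup s phi => fun a => sup [set feval phi (vsnoc a c) | c in @setT (M s)]
  | Inf s phi => fun a => inf [set feval phi (vsnoc a c) | c in @setT (M s)]
  end.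

(* The formula [phi] stands for the condition [phi = 0]. *)
Definition theory : Type := set (formula (empty_ctx L)).

Definition model (T : theory) M : Prop :=
  forall phi, T phi -> feval phi (@vempty M) = 0.

(** * Stability and the bound N(phi, eps) *)

Section Stability.
Variables (T : theory) (X Y : ctx L) (phi : formula (cat_ctx X Y)).

Definition eps_stable (eps : R) : Prop :=
  ~ exists M, model T M /\
    exists (a : nat -> valuation M X) (b : nat -> valuation M Y),
      forall i j : nat, (i < j)%N ->
        eps <= `|feval phi (vcat (a i) (b j)) - feval phi (vcat (a j) (b i))|.

Definition stable : Prop := forall eps : R, 0 < eps -> eps_stable eps.

Definition no_long_sequence (eps : R) (n : nat) : Prop :=
  ~ exists M, model T M /\
    exists (a : 'I_n.+1 -> valuation M X) (b : 'I_n.+1 -> valuation M Y),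
      forall i j k : 'I_n.+1, (i < j)%N -> (j < k)%N ->
        eps <= `|feval phi (vcat (a j) (b i)) - feval phi (vcat (a j) (b k))|.

(* The least [n] with [no_long_sequence eps n]; the default value 0 is taken
   only when there is no such [n]. *)
Definition Nbound (eps : R) : nat :=
  xget 0%N [set n | no_long_sequence eps n /\
                    forall k, no_long_sequence eps k -> (n <= k)%N].

End Stability.

(** * The predicate d phi *)

(* Truth values lie in [0, 1], so 1 and 0 are neutral for min and max. *)
Definition med n (t : 'I_(2 * n).-1 -> R) : R :=
  \big[Num.min/1]_(w : {set 'I_(2 * n).-1} | #|w| == n)
    \big[Num.max/0]_(i in w) t i.

Definition clamp (l u a : R) : R := Num.max l (Num.min u a).

Lemma clamp_closest (l u a : R) : l <= u ->
  l <= clamp l u a <= u /\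
  forall z, l <= z <= u -> `|clamp l u a - a| <= `|z - a|.
Proof.
move=> lu; rewrite /clamp; split.
  by rewrite le_max lexx /= ge_max lu ge_min lexx.
move=> z /andP[lz zu].
have [ua|au] := leP u a.
  rewrite (max_idPr lu).
  by rewrite ler0_norm ?subr_le0// ler0_norm ?subr_le0 ?(le_trans zu)// lerN2 lerD2r.
have [al|la] := leP l a; first by rewrite subrr normr0.
by rewrite !ger0_norm ?subr_ge0 ?(ltW la)// ?lerD2r// (le_trans (ltW la)).
Qed.

Fixpoint fseq (a : nat -> R) (n : nat) : R :=
  if n is k.+1 then
    clamp (fseq a k - 2 ^- k.+1) (fseq a k + 2 ^- k.+1) (a k.+1)
  else a 0%N.

Definition flim (a : nat -> R) : R := lim (fseq a @ \oo).

Section DPhi.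
Variables (T : theory) (X Y : ctx L) (phi : formula (cat_ctx X Y)).

Definition deps (eps : R) M (b : valuation M Y)
    (a : 'I_(2 * Nbound T phi eps).-1 -> valuation M X) : R :=
  med (fun i => feval phi (vcat (a i) b)).

(* Values in [M] for the variables X = (x^n_i). *)
Definition dparams M : Type :=
  forall n : nat, 'I_(2 * Nbound T phi (2 ^- n)).-1 -> valuation M X.

Definition dphi M (b : valuation M Y) (C : dparams M) : R :=
  flim (fun n => deps b (C n)).

End DPhi.

(** * Elementary extensions and types *)

Record elext M := Elext {
  elext_str :> structure L;
  elext_map : forall s, M s -> elext_str s;
  elext_elem : forall X (phi : formula X) (a : valuation M X),
    feval phi (fun v => elext_map (a v) : elext_str (vsort X v))
    = feval phi a }.

Definition vmap M (N : elext M) X (a : valuation M X) : valuation N X :=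
  fun v => elext_map N (a v).

(* A formula psi(x, c) with parameters c in M. *)
Record pformula M X := PFormula {
  pf_size : nat;
  pf_sort : 'I_pf_size -> sorts L;
  pf_form : formula (cat_ctx X (tuple_ctx pf_sort));
  pf_par : valuation M (tuple_ctx pf_sort) }.
Arguments pf_par {M X} p _.

Record extpoint M X := ExtPoint {
  point_ext : elext M;
  point_val : valuation point_ext X }.

Definition pfeval M X (psi : pformula M X) (r : extpoint M X) : R :=
  feval (pf_form psi) (vcat (point_val r) (vmap (point_ext r) (pf_par psi))).

Definition conditions_of M X (r : extpoint M X) : set (pformula M X) :=
  [set psi | pfeval psi r = 0].

Record stype M X := SType {
  stype_set : set (pformula M X);
  stype_realised : exists r : extpoint M X, stype_set = conditions_of r }.

Definition tp M X (r : extpoint M X) : stype M X :=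
  @SType M X (conditions_of r) (ex_intro _ r erefl).

Definition realisation M X (p : stype M X) : extpoint M X :=
  projT1 (cid (stype_realised p)).

Definition typeval M X (psi : pformula M X) (p : stype M X) : R :=
  pfeval psi (realisation p).

HB.instance Definition _ M X := gen_eqMixin (stype M X).
HB.instance Definition _ M X := gen_choiceMixin (stype M X).

(* Coarsest topology making each [typeval psi] continuous. *)
Definition stype_sup M X : Type :=
  sup_topology (fun psi : pformula M X =>
    Topological.class (initial_topology (typeval psi))).
HB.instance Definition _ M X := Topological.on (stype_sup M X).
HB.instance Definition _ M X := Topological.copy (stype M X) (stype_sup M X).

End Semantics.

Section PhiTypes.
Variables (R : realType) (L : signature R) (X : ctx L).
Variables (n : nat) (sy : 'I_n -> sorts L).
Local Notation Y := (tuple_ctx sy).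
Variables (phi : formula (cat_ctx X Y)) (M : structure L).

(* The value of phi(x, b) at p, for b in M. *)
Definition instval (p : stype M X) (b : valuation M Y) : R :=
  typeval (PFormula phi b) p.

Definition phi_eqv : rel (stype M X) :=
  fun p q => `[< forall b, instval p b = instval q b >].

Lemma phi_eqv_refl : reflexive phi_eqv.
Proof. by move=> p; apply/asboolP. Qed.

Lemma phi_eqv_sym : symmetric phi_eqv.
Proof. by move=> p q; apply/asboolP/asboolP => h b; rewrite h. Qed.

Lemma phi_eqv_trans : transitive phi_eqv.
Proof.
by move=> q p r /asboolP pq /asboolP qr; apply/asboolP => b; rewrite pq.
Qed.

Canonical phi_eqv_rel :=
  EquivRel phi_eqv phi_eqv_refl phi_eqv_sym phi_eqv_trans.

Definition phitype : Type := quotient_topology {eq_quot phi_eqv_rel}%qT.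
HB.instance Definition _ := Topological.on phitype.
HB.instance Definition _ := Quotient.on phitype.

Definition phitype_of (p : stype M X) : phitype := (\pi p)%qT.

(* The value of phi(x, b) at a class p. *)
Definition phival (p : phitype) (b : valuation M Y) : R :=
  instval (repr p) b.

End PhiTypes.

(** * Definable predicates *)

(* An M-definable predicate is represented by a function on the space of
   types over M, evaluated at a point [r] as [psi (tp r)]. *)
Definition definable_predicate (R : realType) (L : signature R)
    (M : structure L) (Y : ctx L) (psi : stype M Y -> R) : Prop :=
  continuous psi /\ forall q, 0 <= psi q <= 1.

Definition elext_id (R : realType) (L : signature R) (M : structure L) :
    elext M :=
  @Elext R L M M (fun s a => a) (fun X phi a => erefl).

Definition point_in (R : realType) (L : signature R) (M : structure L)
    (Y : ctx L) (b : valuation M Y) : extpoint M Y :=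
  @ExtPoint R L M Y (elext_id M) b.

Section Definitions.
Variables (R : realType) (L : signature R) (m n : nat).
Variables (sx : 'I_m -> sorts L) (sy : 'I_n -> sorts L).
Local Notation X := (tuple_ctx sx).
Local Notation Y := (tuple_ctx sy).
Variables (phi : formula (cat_ctx X Y)) (M : structure L).

Definition is_definition (p : phitype phi M) (psi : stype M Y -> R) : Prop :=
  definable_predicate psi /\
  forall b : valuation M Y, phival p b = psi (tp (point_in b)).

Definition tilde_predicate (psi : stype M Y -> R) : Prop :=
  exists g : phitype (tilde phi) M -> R,
    [/\ continuous g, (forall q, 0 <= g q <= 1)
      & forall q, psi q = g (phitype_of (tilde phi) q)].

End Definitions.

(* Main.v *)
Require Import Defs.
From mathcomp Require Import all_boot all_order all_algebra.
From mathcomp Require Import all_classical all_reals all_analysis.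
From mathcomp Require Import lra zify.
Import Order.TTheory GRing.Theory Num.Theory.
Import numFieldNormedType.Exports.

Set Implicit Arguments.
Unset Strict Implicit.
Unset Printing Implicit Defensive.

Local Open Scope classical_set_scope.
Local Open Scope ring_scope.

(** Why the proposition holds. A type p in S_phi(M) is realised by some point a
    of an elementary extension of M. Such a point can be imitated inside M: for
    finitely many formulae with parameters in M there is c in M giving all of
    them nearly the values they have at a (finitely_approximable). So the
    function b |-> phi(a, b) on M is approximated, finitely many b at a time,
    by functions b |-> phi(c, b) with c in M, and stability has to turn this
    into uniform approximation.

    Let N = N(phi, eps). The parameters c_i, for i < 2N - 1, are chosen one
    after the other, each agreeing with a at finitely many points b prepared
    from the earlier choices. If their median at some b in M were off by more
    than eps, then N of them would err at b in the same direction by more than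
    eps, and the prepared points would form with these N parameters one of the
    sequences forbidden by the definition of N (far_pattern). That definition
    compares phi(a_j, b_i) with phi(a_j, b_k), whereas the construction only
    compares both with the values phi(a, b_i) and phi(a, b_k) they are meant to
    approximate. The prepared points are therefore chosen to make phi(a, b)
    nearly minimal (or maximal, for errors in the other direction), which makes
    the values phi(a, b_i) monotone in i up to an arbitrarily small loss. The
    loss is harmless because the sequences forbidden for eps are already
    forbidden for some eps' < eps (no_long_sequence_open). Hence the median is
    within eps of phi(a, b) for every b in M (median_approximation), and the
    forced limit of the medians for eps = 2^-n is exactly phi(a, b)
    (flim_close).

    The bound N exists (no_long_sequence_exists) and may be kept for a smaller
    eps' by compactness: a sequence of models with longer and longer, or better
    and better, forbidden sequences has an ultraproduct with an infinite, or
    exact, one, by the theorem of Łoś (ultra_feval). An infinite forbidden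
    sequence contradicts stability by a Ramsey argument along an ultrafilter.

    Finally, d phi(y, C) depends continuously on the type of y, because the
    median and the forced limit are Lipschitz for the uniform distance, and it
    depends only on the values phi(c, y) for c in M; so it is a definable
    tilde phi-predicate. It is the only definition of p because the types of
    tuples of M are dense in the space of types over M
    (types_in_model_dense). *)

(** * Powers of one half *)

Lemma pow2_gt0 (R : realType) n : 0 < 2 ^- n :> R.
Proof. by rewrite invr_gt0 exprn_gt0. Qed.

Lemma pow2_half (R : realType) n : 2 ^- n.+1 = 2 ^- n / 2 :> R.
Proof. by rewrite exprS invfM mulrC. Qed.

Lemma pow2_anti (R : realType) m n : (m <= n)%N -> 2 ^- n <= 2 ^- m :> R.
Proof. by move=> mn; rewrite lef_pV2 ?posrE ?exprn_gt0 // ler_eXn2l ?ltr1n. Qed.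

Lemma pow2_small (R : realType) (e : R) : 0 < e -> exists n, 2 ^- n <= e.
Proof.
move=> e0; have [n _ /(_ n (leqnn n)) /ltW] := near_infty_natSinv_expn_lt (PosNum e0).
by rewrite div1r; exists n.
Qed.

(** * Values of formulae *)

Section Values.
Variables (R : realType) (L : signature R).
Implicit Types (X Y Z : ctx L) (M N : structure L).

Lemma some_elt M s : exists c : M s, True.
Proof. by case: (carrier_inhabited M s) => c; exists c. Qed.

Definition default_valuation M X : valuation M X :=
  fun v => projT1 (cid (some_elt M (vsort X v))).

Lemma feval_bounds M X (psi : formula X) (a : valuation M X) :
  0 <= feval psi a <= 1.
Proof.
elim: psi a => [Y P t|Y psi IH|Y psi IH|Y psi1 IH1 psi2 IH2|Y s psi IH|Y s psi IH] a /=.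
- exact: ipred_bounds.
- by have := IH a; lra.
- by have := IH a; lra.
- have /andP[? ?] := IH1 a; have /andP[? ?] := IH2 a.
  by rewrite le_max lexx orbT ge_max ler01 andbT lerBlDr ler_wpDr.
- have [c _] := some_elt M s.
  have ubS : ubound [set feval psi (vsnoc a c0) | c0 in [set: M s]] 1.
    by move=> _ [d _ <-]; case/andP: (IH (vsnoc a d)).
  apply/andP; split; last by apply: ge_sup => //; exists (feval psi (vsnoc a c)), c.
  case/andP: (IH (vsnoc a c)) => le0 _; apply: le_trans le0 _.
  by apply: ub_le_sup; [exists 1|exists c].
- have [c _] := some_elt M s.
  have lbS : lbound [set feval psi (vsnoc a c0) | c0 in [set: M s]] 0.
    by move=> _ [d _ <-]; case/andP: (IH (vsnoc a d)).
  apply/andP; split; first by apply: lb_le_inf => //; exists (feval psi (vsnoc a c)), c.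
  case/andP: (IH (vsnoc a c)) => _; apply: le_trans.
  by apply: ge_inf; [exists 0|exists c].
Qed.

Lemma feval_ge0 M X (psi : formula X) (a : valuation M X) : 0 <= feval psi a.
Proof. by case/andP: (feval_bounds psi a). Qed.

Lemma feval_le1 M X (psi : formula X) (a : valuation M X) : feval psi a <= 1.
Proof. by case/andP: (feval_bounds psi a). Qed.

Lemma Inf_le M X s (psi : formula (snoc_ctx X s)) (a : valuation M X) (c : M s) :
  feval (Inf psi) a <= feval psi (vsnoc a c).
Proof. by apply: ge_inf; [exists 0 => _ [d _ <-]; exact: feval_ge0|exists c]. Qed.

Lemma Inf_approx M X s (psi : formula (snoc_ctx X s)) (a : valuation M X) (e : R) :
  0 < e -> exists c : M s, feval psi (vsnoc a c) <= feval (Inf psi) a + e.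
Proof.
move=> e0; have [c0 _] := some_elt M s.
have [|_ [c _ <-] /ltW le_c] :=
    @inf_adherent _ [set feval psi (vsnoc a c) | c in [set: M s]] _ e0.
  by split; [exists (feval psi (vsnoc a c0)), c0|exists 0 => _ [d _ <-]; exact: feval_ge0].
by exists c.
Qed.

Lemma Sup_ge M X s (psi : formula (snoc_ctx X s)) (a : valuation M X) (c : M s) :
  feval psi (vsnoc a c) <= feval (Sup psi) a.
Proof. by apply: ub_le_sup; [exists 1 => _ [d _ <-]; exact: feval_le1|exists c]. Qed.

Lemma Sup_approx M X s (psi : formula (snoc_ctx X s)) (a : valuation M X) (e : R) :
  0 < e -> exists c : M s, feval (Sup psi) a - e <= feval psi (vsnoc a c).
Proof.
move=> e0; have [c0 _] := some_elt M s.
have [|_ [c _ <-] /ltW le_c] :=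
    @sup_adherent _ [set feval psi (vsnoc a c) | c in [set: M s]] _ e0.
  by split; [exists (feval psi (vsnoc a c0)), c0|exists 1 => _ [d _ <-]; exact: feval_le1].
by exists c.
Qed.

Lemma teval_subst M X Y (h : subst_map X Y) s (t : term X s) (a : valuation M Y) :
  teval a (tsubst h t) = teval (fun v => teval a (h v)) t.
Proof. by elim: t => [//|f t IH] /=; congr ifun; apply: functional_extensionality_dep. Qed.

Lemma feval_subst M X Y (h : subst_map X Y) (psi : formula X) (a : valuation M Y) :
  feval (fsubst h psi) a = feval psi (fun v => teval a (h v)).
Proof.
elim: psi Y h a => [X0 P t|X0 psi IH|X0 psi IH|X0 psi1 IH1 psi2 IH2|X0 s psi IH|X0 s psi IH]
  Y h a /=; try by rewrite ?IH ?IH1 ?IH2.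
- congr ipred; apply: functional_extensionality_dep => i; exact: teval_subst.
- congr sup; congr image; apply/funext => c; rewrite IH; congr feval.
  apply: functional_extensionality_dep => -[v|//] /=; exact: teval_subst.
- congr inf; congr image; apply/funext => c; rewrite IH; congr feval.
  apply: functional_extensionality_dep => -[v|//] /=; exact: teval_subst.
Qed.

Definition fmax X (f g : formula X) : formula X := Neg (Monus (Neg f) (Monus g f)).

(** Since truth values are at most 1, the truncations in fmax are harmless. *)
Lemma feval_max M X (f g : formula X) (a : valuation M X) :
  feval (fmax f g) a = Num.max (feval f a) (feval g a).
Proof.
rewrite /=; have := feval_bounds f a; have := feval_bounds g a.
move: (feval f a) (feval g a) => x y /andP[? ?] /andP[? ?].
by case: (leP x y) => ?; case: (leP (y - x) 0) => ?; case: leP => ?; lra.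
Qed.

Definition fabsdiff X (f g : formula X) := fmax (Monus f g) (Monus g f).

Lemma feval_absdiff M X (f g : formula X) (a : valuation M X) :
  feval (fabsdiff f g) a = `|feval f a - feval g a|.
Proof.
rewrite feval_max /= -[feval g a - _]opprB; move: (_ - _) => u.
have [u0|/ltW u0] := leP 0 u.
  by rewrite ger0_norm// (@max_r _ _ (- u)) ?oppr_le0// max_l.
by rewrite ler0_norm// (@max_l _ _ (- u)) ?oppr_ge0// max_r ?oppr_ge0.
Qed.

(** The connectives only give dyadic constants: 0 is the difference of base with
    itself, and the others are obtained by halving and by t |-> (1 + t) / 2.
    These are dense in the unit interval. *)
Lemma const_formula X (base : formula X) (t e : R) : 0 <= t <= 1 -> 0 < e ->
  exists f : formula X, forall M (a : valuation M X), `|feval f a - t| <= e.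
Proof.
move=> t01 e0; have [n ne] := pow2_small e0.
suff [f ft] : exists f : formula X,
    forall M (a : valuation M X), `|feval f a - t| <= 2 ^- n.
  by exists f => M a; apply: le_trans (ft M a) ne.
move: t t01; elim: n {ne} => [|n IH] t t01.
  exists (Monus base base) => M a /=.
  by rewrite subrr maxxx sub0r normrN expr0 invr1 ger0_norm; lra.
have [th|th] := leP t (1 / 2).
  have [|f ft] := IH (2 * t); first by lra.
  exists (Half f) => M a /=.
  by rewrite pow2_half; have := ft M a; rewrite !ler_norml; lra.
have [|f ft] := IH (2 * t - 1); first by lra.
exists (Neg (Half (Neg f))) => M a /=.
by rewrite pow2_half; have := ft M a; rewrite !ler_norml; lra.
Qed.

End Values.
Arguments default_valuation {R L} M X.

(** * Infima over finitely many variables *)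

Section InfVars.
Variables (R : realType) (L : signature R).
Implicit Types (X Y Z : ctx L) (M N : structure L).

Definition update M Z (a : valuation M Z) (v0 : var Z) (c : M (vsort Z v0)) :
    valuation M Z :=
  fun v => match pselect (v0 = v) with
  | left e => eq_rect v0 (fun w => M (vsort Z w)) c v e
  | right _ => a v end.

(** Moves v0 to the last place, where a quantifier can bind it; the variable v0
    stays in the context but no longer occurs. This keeps the context fixed when
    several variables are quantified in turn. *)
Definition last_var Z (v0 : var Z) : subst_map Z (snoc_ctx Z (vsort Z v0)) :=
  fun v => match pselect (v0 = v) with
  | left e => eq_rect v0 (fun w => term (snoc_ctx Z (vsort Z v0)) (vsort Z w))
                (Var (snoc_ctx Z (vsort Z v0)) None) v e
  | right _ => Var (snoc_ctx Z (vsort Z v0)) (Some v) end.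

Definition inf_var Z (v0 : var Z) (psi : formula Z) : formula Z :=
  Inf (fsubst (last_var v0) psi).

Lemma feval_last_var M Z (v0 : var Z) (psi : formula Z) (a : valuation M Z)
    (c : M (vsort Z v0)) :
  feval (fsubst (last_var v0) psi) (vsnoc a c) = feval psi (update a c).
Proof.
rewrite feval_subst; congr feval; apply: functional_extensionality_dep => v.
by rewrite /last_var /update; case: pselect => // e; case: v / e.
Qed.

Lemma inf_var_le M Z (v0 : var Z) (psi : formula Z) (a b : valuation M Z) :
  (forall v, v <> v0 -> a v = b v) -> feval (inf_var v0 psi) a <= feval psi b.
Proof.
move=> ab; apply: le_trans (Inf_le _ a (b v0)) _.
rewrite feval_last_var; suff -> : update a (b v0) = b by [].
apply: functional_extensionality_dep => v; rewrite /update; case: pselect => [e|ne].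
  by case: v / e.
by apply: ab => /esym.
Qed.

Lemma inf_var_approx M Z (v0 : var Z) (psi : formula Z) (a : valuation M Z) (e : R) :
  0 < e -> exists2 b : valuation M Z, forall v, v <> v0 -> a v = b v
    & feval psi b <= feval (inf_var v0 psi) a + e.
Proof.
move=> e0; have [c] := Inf_approx (fsubst (last_var v0) psi) a e0.
rewrite feval_last_var => le_c; exists (update a c) => // v vv0.
by rewrite /update; case: pselect => // e1; case: vv0.
Qed.

Definition inf_vars Z (I : Type) (f : I -> var Z) (s : seq I) (psi : formula Z) :=
  foldr (fun i => inf_var (f i)) psi s.

Lemma inf_vars_le M Z (I : eqType) (f : I -> var Z) (s : seq I) (psi : formula Z)
    (a b : valuation M Z) :
  (forall v, (forall i, i \in s -> v <> f i) -> a v = b v) ->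
  feval (inf_vars f s psi) a <= feval psi b.
Proof.
elim: s a => [|i s IH] a ab /=.
  by have -> : a = b; first by apply: functional_extensionality_dep => v; exact: ab.
apply: le_trans (inf_var_le (v0 := f i) _ (b := update a (b (f i))) _) _.
  by move=> v vi; rewrite /update; case: pselect => // e; case: vi.
apply: IH => v vs; rewrite /update; case: pselect => [e|ne]; first by case: v / e vs.
by apply: ab => j; rewrite in_cons => /orP[/eqP ->|/vs//] /esym.
Qed.

Lemma inf_vars_approx M Z (I : eqType) (f : I -> var Z) (s : seq I) (psi : formula Z)
    (a : valuation M Z) (e : R) : 0 < e ->
  exists2 b : valuation M Z, forall v, (forall i, i \in s -> v <> f i) -> a v = b v
    & feval psi b <= feval (inf_vars f s psi) a + e.
Proof.
elim: s a e => [|i s IH] a e e0 /=; first by exists a => //; rewrite lerDl ltW.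
have e2 : 0 < e / 2 by lra.
have [b ab le_b] := inf_var_approx (f i) (inf_vars f s psi) a e2.
have [b' bb' le_b'] := IH b _ e2.
exists b' => [v vs|]; last by lra.
rewrite ab ?bb' //; last by apply: vs; rewrite mem_head.
by move=> j js; apply: vs; rewrite in_cons js orbT.
Qed.

End InfVars.

(** * Metrics and limits along an ultrafilter *)

Lemma choice_dep (T : nat -> Type) (P : forall k, T k -> Prop) :
  (forall k, exists z, P k z) -> exists x : forall k, T k, forall k, P k (x k).
Proof. by move=> ex; exists (fun k => projT1 (cid (ex k))) => k; case: cid. Qed.

Section Metric.
Variables (R : realType) (L : signature R) (M : structure L) (s : sorts L).
Implicit Types a b : M s.

Lemma dist_ge0 a b : 0 <= dist a b.
Proof.
by case/andP: (ipred_bounds (P := Dist s)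
  (fun i : 'I_2 => if val i is 0%N then a else b)).
Qed.

Lemma dist_le1 a b : dist a b <= 1.
Proof.
by case/andP: (ipred_bounds (P := Dist s)
  (fun i : 'I_2 => if val i is 0%N then a else b)).
Qed.

Lemma distxx a : dist a a = 0.
Proof. exact/dist_eq0. Qed.

End Metric.

Section Ultralimit.
Variables (R : realType) (U : set_system nat).
Context {UU : UltraFilter U}.

#[local] Instance ultra_pfilter : ProperFilter U := ultra_proper.

(** A cluster point, which exists by compactness, is a limit: an ultrafilter
    contains the preimage of each of its neighbourhoods or the complement. *)
Lemma bounded_ultracvg (f : nat -> R) : (forall k, 0 <= f k <= 1) ->
  exists l : R, f k @[k --> U] --> l.
Proof.
move=> f01; have [|l [_ cl]] := @segment_compact R 0 1 (f k @[k --> U]) _.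
  by apply: (@filterE _ U) => k; rewrite /= in_itv /=; exact: f01.
exists l => V Vl; have [//|UnV] := in_ultra_setVsetC (f @^-1` V) UU.
by have [y [/= nVy Vy]] := cl (~` V) V UnV Vl.
Qed.

Definition ulim (f : nat -> R) : R := lim (f k @[k --> U]).

Lemma ulimP (f : nat -> R) : (forall k, 0 <= f k <= 1) -> f k @[k --> U] --> ulim f.
Proof. by move=> /bounded_ultracvg [l fl]; apply/cvg_ex; exists l. Qed.

Lemma ulim_eq (f : nat -> R) (l : R) : f k @[k --> U] --> l -> ulim f = l.
Proof. by move=> fl; apply: cvg_lim. Qed.

Lemma ulim_bounds (f : nat -> R) : (forall k, 0 <= f k <= 1) -> 0 <= ulim f <= 1.
Proof.
move=> f01; apply/andP; split.
  by apply: cvgr_to_ge (ulimP f01) _; apply: nearW => k; case/andP: (f01 k).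
by apply: cvgr_to_le (ulimP f01) _; apply: nearW => k; case/andP: (f01 k).
Qed.

End Ultralimit.

(** * Ultraproducts of structures *)

Section Ultraproduct.
Variables (R : realType) (L : signature R) (Mk : nat -> structure L).
Variables (U : set_system nat).
Context {UU : UltraFilter U}.
#[local] Instance ultra_pfilter' : ProperFilter U := ultra_proper.

Definition family (s : sorts L) : Type := forall k, Mk k s.

Definition infinitely_close s (x y : family s) : Prop :=
  forall e : R, 0 < e -> \forall k \near U, dist (x k) (y k) < e.

Lemma close_refl s (x : family s) : infinitely_close x x.
Proof. by move=> e e0; apply: nearW => k; rewrite distxx. Qed.

Lemma close_sym s (x y : family s) : infinitely_close x y -> infinitely_close y x.
Proof. by move=> xy e e0; near do rewrite dist_sym; exact: xy. Unshelve. all: end_near. Qed.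

Lemma close_trans s (x y z : family s) :
  infinitely_close x y -> infinitely_close y z -> infinitely_close x z.
Proof.
move=> xy yz e e0; have e2 : 0 < e / 2 by lra.
near=> k; apply: le_lt_trans (dist_triangle _ (y k) _) _.
have : dist (x k) (y k) < e / 2 by near: k; exact: xy.
have : dist (y k) (z k) < e / 2 by near: k; exact: yz.
lra.
Unshelve. all: end_near. Qed.

Section Continuity.
Variables (n : nat) (S : 'I_n -> sorts L) (W : nat -> Type).
Variables (G : forall k, (forall i, Mk k (S i)) -> W k).
Variables (dW : forall k, W k -> W k -> R) (mo : 'I_n -> modulus R).
Hypothesis dWxx : forall k (w : W k), dW w w = 0.
Hypothesis dW_triangle : forall k (u v w : W k), dW u w <= dW u v + dW v w.
Hypothesis G_unif : forall k (i : 'I_n) (a b : forall i, Mk k (S i)),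
  (forall j, j != i -> a j = b j) ->
  forall e : R, 0 < e -> dist (a i) (b i) < mo i e -> dW (G a) (G b) <= e.

(** The moduli control one argument at a time; replacing the arguments one
    after the other gives continuity in all of them together. *)
Lemma close_congr (x y : forall i, family (S i)) :
  (forall i, infinitely_close (x i) (y i)) ->
  forall e : R, 0 < e ->
    \forall k \near U, dW (G (fun i => x i k)) (G (fun i => y i k)) <= e.
Proof.
move=> xy; pose h m k (i : 'I_n) := if (i < m)%N then y i k else x i k.
suff hyb m : (m <= n)%N -> forall e : R, 0 < e ->
    \forall k \near U, dW (G (fun i => x i k)) (G (h m k)) <= e.
  move=> e e0; have := hyb n (leqnn n) e e0; apply: filterS => k.
  suff -> : h n k = (fun i => y i k) by [].
  by apply: functional_extensionality_dep => i; rewrite /h ltn_ord.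
elim: m => [|m IH] mn e e0.
  by apply: nearW => k; rewrite [h 0%N k](_ : _ = (fun i => x i k)) // dWxx ltW.
have e2 : 0 < e / 2 by lra.
near=> k; apply: le_trans (dW_triangle _ (G (h m k)) _) _.
have : dW (G (fun i => x i k)) (G (h m k)) <= e / 2.
  by near: k; apply: IH => //; exact: ltnW.
suff : dW (G (h m k)) (G (h m.+1 k)) <= e / 2 by lra.
apply: (G_unif (i := Ordinal mn)) => //.
  move=> j jm; rewrite /h ltnS [(j <= m)%N]leq_eqVlt.
  by have /negbTE -> : (j != m :> nat) := jm.
rewrite /h /= ltnn ltnSn; near: k; apply: xy; exact: delta_gt0.
Unshelve. all: end_near. Qed.

End Continuity.

Definition default_family s : family s := fun k => projT1 (cid (some_elt (Mk k) s)).

(** The elements of the ultraproduct are the families which are their own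
    chosen representative in the class of infinitely close families. *)
Definition normal_form s (x : family s) : family s :=
  xget (default_family s : {classic family s}) [set y | infinitely_close x y].

Lemma normal_form_close s (x : family s) : infinitely_close x (normal_form x).
Proof.
apply: (@xgetPex {classic family s} _ [set y | infinitely_close x y]).
by exists x; exact: close_refl.
Qed.

Lemma normal_form_eq s (x y : family s) :
  infinitely_close x y -> normal_form x = normal_form y.
Proof.
move=> xy; rewrite /normal_form.
suff -> : [set z | infinitely_close x z] = [set z | infinitely_close y z] by [].
by apply/seteqP; split => z /=; apply: close_trans => //; exact: close_sym.
Qed.

Record uelt s := UElt { urep : family s; urepK : normal_form urep = urep }.

Definition class s (x : family s) : uelt s :=
  UElt (esym (normal_form_eq (normal_form_close x))).

Lemma uelt_eq s (u v : uelt s) : urep u = urep v -> u = v.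
Proof.
case: u v => [x xK] [y yK] /= xy; case: y / xy yK => yK.
by rewrite (Prop_irrelevance xK yK).
Qed.

Lemma class_eq s (x y : family s) : infinitely_close x y -> class x = class y.
Proof. by move=> xy; apply: uelt_eq; exact: normal_form_eq. Qed.

Lemma class_urep s (u : uelt s) : class (urep u) = u.
Proof. by apply: uelt_eq => /=; exact: urepK. Qed.

Lemma urep_class s (x : family s) : infinitely_close (urep (class x)) x.
Proof. by apply: close_sym; exact: normal_form_close. Qed.

Definition ultra_pre : prestructure R L :=
  @Prestructure R L uelt
    (fun f a => class (fun k => ifun (Mk k) f (fun i => urep (a i) k)))
    (fun P a => ulim U (fun k => ipred (Mk k) P (fun i => urep (a i) k))).

Lemma ultra_distE s (u v : ultra_pre s) :
  dist u v = ulim U (fun k => dist (urep u k) (urep v k)).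
Proof.
rewrite /dist /=; congr ulim; apply/funext => k; congr ipred.
by apply: functional_extensionality_dep => i; case: (val i).
Qed.

Lemma ultra_dist_cvg s (u v : ultra_pre s) :
  dist (urep u k) (urep v k) @[k --> U] --> dist u v.
Proof. by rewrite ultra_distE; apply: ulimP => k; rewrite dist_ge0 dist_le1. Qed.
Arguments ultra_dist_cvg {s} u v.

Lemma ultra_dist_lt s (u v : ultra_pre s) (e : R) : dist u v < e ->
  \forall k \near U, dist (urep u k) (urep v k) < e.
Proof. exact: cvgr_lt (ultra_dist_cvg u v) e. Qed.

Lemma ultra_dist_le s (u v : ultra_pre s) (e : R) :
  (\forall k \near U, dist (urep u k) (urep v k) <= e) -> dist u v <= e.
Proof. exact: cvgr_to_le (ultra_dist_cvg u v). Qed.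

Lemma ultra_dist_ge0 s (u v : ultra_pre s) : 0 <= dist u v.
Proof.
by apply: cvgr_to_ge (ultra_dist_cvg u v) _; apply: nearW => k; exact: dist_ge0.
Qed.

Lemma ultra_dist_eq0 s (u v : ultra_pre s) : dist u v = 0 <-> u = v.
Proof.
split=> [uv0|->].
  rewrite -(class_urep u) -(class_urep v); apply: class_eq => e e0.
  by apply: ultra_dist_lt; rewrite uv0.
rewrite ultra_distE; apply: ulim_eq; under eq_fun do rewrite distxx; exact: cvg_cst.
Qed.

Lemma ultra_dist_sym s (u v : ultra_pre s) : dist u v = dist v u.
Proof. by rewrite !ultra_distE; congr ulim; apply/funext => k; exact: dist_sym. Qed.

Lemma ultra_dist_triangle s (u v w : ultra_pre s) : dist u w <= dist u v + dist v w.
Proof.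
apply: ler_cvg_to (ultra_dist_cvg u w) (cvgD (ultra_dist_cvg u v) (ultra_dist_cvg v w)) _.
by apply: nearW => k; exact: dist_triangle.
Qed.

Lemma ultra_ipred_cvg P (a : forall i, ultra_pre (pdom P i)) :
  ipred (Mk k) P (fun i => urep (a i) k) @[k --> U] --> ipred ultra_pre P a.
Proof. by apply: ulimP => k; exact: ipred_bounds. Qed.
Arguments ultra_ipred_cvg {P} a.

Lemma ultra_ipred_bounds P (a : forall i, ultra_pre (pdom P i)) :
  0 <= ipred ultra_pre P a <= 1.
Proof. by apply: ulim_bounds => k; exact: ipred_bounds. Qed.

Lemma ultra_ipred_unif P (i : 'I_(parity P)) (a b : forall i, ultra_pre (pdom P i)) :
  (forall j, j != i -> a j = b j) ->
  forall e : R, 0 < e -> dist (a i) (b i) < pmod P i e ->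
  `|ipred ultra_pre P a - ipred ultra_pre P b| <= e.
Proof.
move=> ab e e0 abe.
apply: cvgr_to_le (cvg_norm (cvgB (ultra_ipred_cvg a) (ultra_ipred_cvg b))) _.
have := ultra_dist_lt abe; apply: filterS => k abk.
by apply: (ipred_unif (i := i)) => // j ji; rewrite ab.
Qed.

Lemma ultra_ifun_unif f (i : 'I_(farity f)) (a b : forall i, ultra_pre (fdom f i)) :
  (forall j, j != i -> a j = b j) ->
  forall e : R, 0 < e -> dist (a i) (b i) < fmod f i e ->
  dist (ifun ultra_pre f a) (ifun ultra_pre f b) <= e.
Proof.
move=> ab e e0 abe; apply/ler_addgt0Pr => eta eta0; apply: ultra_dist_le.
have eta2 : 0 < eta / 2 by lra.
near=> k.
set x := fun k => ifun (Mk k) f (fun i => urep (a i) k).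
set y := fun k => ifun (Mk k) f (fun i => urep (b i) k).
have : dist (x k) (y k) <= e.
  apply: (ifun_unif (i := i)) => //; last by near: k; exact: ultra_dist_lt.
  by move=> j ji; rewrite ab.
have : dist (urep (class x) k) (x k) < eta / 2 by near: k; exact: urep_class.
have : dist (urep (class y) k) (y k) < eta / 2 by near: k; exact: urep_class.
have := dist_triangle (urep (class x) k) (x k) (urep (class y) k).
have := dist_triangle (x k) (y k) (urep (class y) k).
rewrite (dist_sym (y k)); lra.
Unshelve. all: end_near. Qed.

Hypothesis U_nonprincipal : \oo `<=` U.

(** Diagonal argument: the Cauchy sequence of families is refined to one with
    known rate, and the limit follows, at the index k, the longest initial
    segment of length at most k on which the rate is respected in the k-th
    structure. *)
Lemma ultra_complete s (u : nat -> ultra_pre s) :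
  (forall e : R, 0 < e -> exists n, forall i j,
     (n <= i)%N -> (n <= j)%N -> dist (u i) (u j) < e) ->
  exists l, (fun i => dist (u i) l) @ \oo --> (0 : R).
Proof.
move=> cauchy.
have [nn nnP] := choice (fun m => cauchy _ (pow2_gt0 R m)).
pose x m := urep (u (nn m)).
have xx i j : dist (u (nn i)) (u (nn j)) < 2 ^- i + 2 ^- j.
  pose t := maxn (nn i) (nn j).
  have := nnP i (nn i) t (leqnn _) (leq_maxl _ _).
  have := nnP j t (nn j) (leq_maxr _ _) (leqnn _).
  have := ultra_dist_triangle (u (nn i)) (u t) (u (nn j)); lra.
pose A m k := (m <= k)%N /\
  forall i j : 'I_m.+1, dist (x i k) (x j k) < 2 ^- i + 2 ^- j.
have UA m : \forall k \near U, A m k.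
  apply: filterI; first by apply: U_nonprincipal; exists m.
  by do 2!apply: filter_forall => ?; exact: ultra_dist_lt.
have [l lP] : exists l : family s, forall k m, A m k -> dist (x m k) (l k) <= 2 * 2 ^- m.
  suff {UA} lk k : exists z : Mk k s, forall m, A m k -> dist (x m k) z <= 2 * 2 ^- m.
    by have [l lP] := choice_dep lk; exists l.
  have [ex|nex] := pselect (exists m, A m k); last first.
    have [z _] := some_elt (Mk k) s; exists z => m Am.
    by case: nex; exists m.
  have ex' : exists m, `[< A m k >] by case: ex => m Am; exists m; apply/asboolP.
  have bd m : `[< A m k >] -> (m <= k)%N by move=> /asboolP [].
  case: (ex_maxnP ex' bd) => M /asboolP [_ AM] Mmax.
  exists (x M k) => m Am; have mM : (m <= M)%N by apply: Mmax; apply/asboolP.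
  have := AM (Ordinal (mM : (m < M.+1)%N)) ord_max => /= /ltW /le_trans; apply.
  have : 2 ^- M <= 2 ^- m :> R by exact: pow2_anti.
  lra.
exists (class l); apply/cvgr0Pnorm_le => e e0.
have [|m me] := @pow2_small R (e / 4); first by lra.
exists (nn m) => // i mi; rewrite ger0_norm ?ultra_dist_ge0 //.
have : dist (u (nn m)) (class l) <= 3 * 2 ^- m.
  apply: ultra_dist_le; near=> k.
  have : dist (x m k) (l k) <= 2 * 2 ^- m by apply: lP; near: k; exact: UA.
  have : dist (urep (class l) k) (l k) < 2 ^- m.
    by near: k; apply: urep_class; exact: pow2_gt0.
  have := dist_triangle (urep (u (nn m)) k) (l k) (urep (class l) k).
  rewrite (dist_sym (l k)); rewrite -/(x m); lra.
have := nnP m i (nn m) mi (leqnn _).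
have := ultra_dist_triangle (u i) (u (nn m)) (class l); lra.
Unshelve. all: end_near. Qed.

Definition ultraproduct : structure L :=
  @Structure R L ultra_pre (fun s => inhabits (class (default_family s)))
    ultra_ipred_bounds ultra_dist_eq0 ultra_dist_sym ultra_dist_triangle
    ultra_complete ultra_ifun_unif ultra_ipred_unif.

Definition class_valuation X (x : forall k, valuation (Mk k) X) : valuation ultraproduct X :=
  fun v => class (fun k => x k v).

Lemma ultra_teval X s (t : term X s) (x : forall k, valuation (Mk k) X) :
  teval (class_valuation x) t = class (fun k => teval (x k) t).
Proof.
elim: t => [//|f t IH].
have /(congr1 (ifun ultraproduct f)) E : (fun i => teval (class_valuation x) (t i)) =
    (fun i => class (fun k => teval (x k) (t i)) : ultraproduct (fdom f i)).
  exact: functional_extensionality_dep.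
apply: etrans E _.
apply: class_eq => e e0; have e2 : 0 < e / 2 by lra.
apply: filterS (close_congr (dW := fun k => @dist R L (Mk k) (fcod f))
    (G := fun k => ifun (Mk k) f) (mo := @fmod R L f) _ _ _ _ e2).
- by move=> k /le_lt_trans; apply; lra.
- by move=> k w; exact: distxx.
- by move=> k; exact: dist_triangle.
- by move=> k i a b ab; exact: ifun_unif.
- by move=> i; exact: urep_class.
Qed.

Lemma class_vsnoc X s (x : forall k, valuation (Mk k) X) (c : family s) :
  class_valuation (fun k => vsnoc (x k) (c k)) =
  vsnoc (class_valuation x) (class c : ultraproduct s).
Proof. by apply: functional_extensionality_dep => -[v|]. Qed.

(** The theorem of Łoś. It is stated for arbitrary families x rather than for
    the normal forms, because the quantifier steps apply it to families of
    near witnesses of the supremum or infimum. *)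
Theorem ultra_feval X (psi : formula X) (x : forall k, valuation (Mk k) X) :
  feval psi (x k) @[k --> U] --> feval psi (class_valuation x).
Proof.
elim: psi x => [X0 P t|X0 psi IH|X0 psi IH|X0 psi1 IH1 psi2 IH2|X0 s psi IH|X0 s psi IH] x.
- pose a : forall i, ultra_pre (pdom P i) := fun i => class (fun k => teval (x k) (t i)).
  have -> : feval (Atom t) (class_valuation x) = ipred ultra_pre P a.
    rewrite [LHS]/=; congr (ipred ultra_pre); apply: functional_extensionality_dep => i.
    exact: ultra_teval.
  apply/cvgrPdist_le => e e0; have e2 : 0 < e / 2 by lra.
  have /cvgrPdist_le /(_ _ e2) := ultra_ipred_cvg a.
  apply: filterS2 (close_congr (dW := fun k (r r' : R) => `|r - r'|)
    (G := fun k => ipred (Mk k) P) (mo := @pmod R L P)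
    (x := fun i => urep (a i)) (y := fun i k => teval (x k) (t i)) _ _ _ _ e2).
  + move=> k near_a near_t.
    by apply: le_trans (ler_distD (ipred (Mk k) P (fun i => urep (a i) k)) _ _) _; lra.
  + by move=> k w; rewrite subrr normr0.
  + by move=> k r1 r2 r3; exact: ler_distD.
  + by move=> k i b c; exact: ipred_unif.
  + by move=> i; exact: urep_class.
- by apply: cvgB; [exact: cvg_cst|exact: IH].
- by apply: cvgMl; exact: IH.
- have maxE (r : R) : Num.max r 0 = (r + `|r|) / 2.
    have [r0|/ltW r0] := leP 0 r; first by rewrite ger0_norm; lra.
    by rewrite ler0_norm; lra.
  have cv : feval psi1 (x k) - feval psi2 (x k) @[k --> U] -->
      feval psi1 (class_valuation x) - feval psi2 (class_valuation x) by exact: cvgB.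
  rewrite /= maxE; under eq_fun do rewrite maxE.
  by apply: cvgMl; apply: cvgD => //; exact: cvg_norm.
(* Each element of the ultraproduct is a family, hence bounded by the suprema
   of the factors; conversely near witnesses in the factors form an element. *)
- pose l := ulim U (fun k => feval (Sup psi) (x k)).
  have Sl : feval (Sup psi) (x k) @[k --> U] --> l.
    by apply: ulimP => k; exact: feval_bounds.
  suff -> : feval (Sup psi) (class_valuation x) = l by [].
  apply/eqP; rewrite eq_le; apply/andP; split.
    apply/ler_addgt0Pr => e e0.
    have [u] := Sup_approx psi (class_valuation x) e0.
    rewrite -(class_urep u) -class_vsnoc => Su.
    suff : feval psi (class_valuation (fun k => vsnoc (x k) (urep u k))) <= l by lra.
    by apply: ler_cvg_to (IH _) Sl _; apply: nearW => k; exact: Sup_ge.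
  apply/ler_addgt0Pr => e e0.
  have [c cP] := choice_dep (fun k => Sup_approx psi (x k) e0).
  apply: (@le_trans _ _ (feval psi (class_valuation (fun k => vsnoc (x k) (c k))) + e)).
    apply: ler_cvg_to Sl (cvgD (IH (fun k => vsnoc (x k) (c k))) (cvg_cst e)) _.
    by apply: nearW => k; rewrite -lerBlDr; exact: cP.
  by rewrite lerD2r class_vsnoc; exact: Sup_ge.
- pose l := ulim U (fun k => feval (Inf psi) (x k)).
  have Sl : feval (Inf psi) (x k) @[k --> U] --> l.
    by apply: ulimP => k; exact: feval_bounds.
  suff -> : feval (Inf psi) (class_valuation x) = l by [].
  apply/eqP; rewrite eq_le; apply/andP; split.
    apply/ler_addgt0Pr => e e0.
    have [c cP] := choice_dep (fun k => Inf_approx psi (x k) e0).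
    apply: (@le_trans _ _ (feval psi (class_valuation (fun k => vsnoc (x k) (c k))))).
      by rewrite class_vsnoc; exact: Inf_le.
    apply: ler_cvg_to (IH _) (cvgD Sl (cvg_cst e)) _.
    by apply: nearW => k; exact: cP.
  apply/ler_addgt0Pr => e e0.
  have [u] := Inf_approx psi (class_valuation x) e0.
  rewrite -(class_urep u) -class_vsnoc => Su.
  apply: le_trans Su.
  by apply: ler_cvg_to Sl (IH _) _; apply: nearW => k; exact: Inf_le.
Qed.

End Ultraproduct.

(** * Compactness and the bound N *)

(** A diagonal choice which replaces the infinite Ramsey theorem for a relation
    Q such that almost every m is related to each n. *)
Lemma filter_chain (F : set_system nat) {FF : ProperFilter F} (P : set nat)
    (Q : nat -> nat -> Prop) :
  F P -> (forall n, P n -> F (Q n)) ->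
  exists x : nat -> nat, (forall i, P (x i)) /\ forall i j, (i < j)%N -> Q (x i) (x j).
Proof.
move=> FP FQ; pose good (s : seq nat) := [set m | P m /\ forall n, n \in s -> Q n m].
pose next (s : seq nat) := xget 0%N (good s).
have goodF (s : seq nat) : (forall n, n \in s -> P n) -> F (good s).
  elim: s => [_|n s IH Ps]; first by apply: filterS FP => m Pm; split.
  have Pn : P n by apply: Ps; rewrite mem_head.
  have Fs : F (good s) by apply: IH => m ms; apply: Ps; rewrite in_cons ms orbT.
  apply: filterS2 (FQ n Pn) Fs => m Qnm [Pm Qm]; split => // k.
  by rewrite in_cons => /orP[/eqP ->|/Qm].
have nextP s : (forall n, n \in s -> P n) -> good s (next s).
  by move=> /goodF /filter_ex ex; exact: xgetPex.
pose st k := iter k (fun s => next s :: s) [::].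
have stP k n : n \in st k -> P n.
  elim: k n => [//|k IH] n; rewrite in_cons => /orP[/eqP ->|/IH//].
  by case: (nextP (st k) IH).
exists (next \o st); split=> [i|i j ij]; first by case: (nextP (st i) (stP i)).
suff ist : next (st i) \in st j by case: (nextP (st j) (stP j)) => _ /(_ _ ist).
elim: j ij => [//|j IH]; rewrite ltnS leq_eqVlt => /orP[/eqP ->|/IH ist].
  by rewrite mem_head.
by rewrite in_cons ist orbT.
Qed.

Section Compactness.
Variables (R : realType) (L : signature R) (T : theory L).
Variables (X Y : ctx L) (phi : formula (cat_ctx X Y)).
Implicit Types M : structure L.

Definition sequence_ctx : ctx L :=
  @Ctx L (nat * (var X + var Y)) (fun v => vsort (cat_ctx X Y) v.2).

Definition entry (i j : nat) : subst_map (cat_ctx X Y) sequence_ctx :=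
  fun v => match v return term sequence_ctx (vsort (cat_ctx X Y) v) with
  | inl v => Var sequence_ctx (i, inl v)
  | inr w => Var sequence_ctx (j, inr w) end.

Definition sequence_valuation M (a : nat -> valuation M X) (b : nat -> valuation M Y) :
    valuation M sequence_ctx :=
  fun v => match v return M (vsort sequence_ctx v) with
  | (i, inl v) => a i v
  | (j, inr w) => b j w end.

Lemma feval_entry M i j (z : valuation M sequence_ctx) :
  feval (fsubst (entry i j) phi) z =
  feval phi (vcat (fun v => z (i, inl v)) (fun w => z (j, inr w))).
Proof.
by rewrite feval_subst; congr feval; apply: functional_extensionality_dep => -[v|w].
Qed.

(** Both uses of compactness concern sequences (a_i, b_i), and only the values
    phi(a_i, b_j) are to be controlled in the limit. *)
Lemma sequence_compactness (Mk : nat -> structure L)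
    (a : forall k, nat -> valuation (Mk k) X) (b : forall k, nat -> valuation (Mk k) Y) :
  (forall k, model T (Mk k)) ->
  exists U : set_system nat, [/\ UltraFilter U, \oo `<=` U &
  exists M, model T M /\
  exists (a' : nat -> valuation M X) (b' : nat -> valuation M Y), forall i j,
    feval phi (vcat (a k i) (b k j)) @[k --> U] --> feval phi (vcat (a' i) (b' j))].
Proof.
move=> MkT; have [U [UU Uoo]] := ultraFilterLemma eventually_filter.
have UF : ProperFilter U := @ultra_proper _ _ UU.
exists U; split => //; exists (ultraproduct Mk Uoo); split.
  move=> theta Ttheta.
  have := @ultra_feval R L Mk U UU Uoo _ theta (fun k => @vempty R L (Mk k)).
  under eq_fun do rewrite (MkT _ _ Ttheta).
  set v := class_valuation _ _; have -> : v = @vempty R L (ultraproduct Mk Uoo).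
    by apply: functional_extensionality_dep => -[].
  move=> cv; apply/esym; apply: (cvg_unique _ _ cv) => //; exact: cvg_cst.
pose z := @class_valuation R L Mk U UU Uoo _ (fun k => sequence_valuation (a k) (b k)).
exists (fun i v => z (i, inl v)), (fun j w => z (j, inr w)) => i j.
rewrite -feval_entry.
have := @ultra_feval R L Mk U UU Uoo _ (fsubst (entry i j) phi)
  (fun k => sequence_valuation (a k) (b k)).
by under eq_fun do rewrite feval_entry.
Qed.

(** Indexing by all natural numbers spares the bounded indices in the sequences
    of no_long_sequence; only the entries up to n matter. *)
Definition bipattern M (eps : R) (n : nat) (a : nat -> valuation M X)
    (b : nat -> valuation M Y) : Prop :=
  forall i j k : nat, (i < j)%N -> (j < k)%N -> (k <= n)%N ->
    eps <= `|feval phi (vcat (a j) (b i)) - feval phi (vcat (a j) (b k))|.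

Lemma no_long_sequenceP (eps : R) (n : nat) : no_long_sequence T phi eps n <->
  ~ exists M, model T M /\ exists a b, @bipattern M eps n a b.
Proof.
split=> no [M [TM [a [b ab]]]]; apply: no; exists M; split => //.
  exists (fun i => a i), (fun i => b i) => i j k ij jk.
  by apply: ab => //; rewrite -ltnS.
exists (fun i => a (inord i)), (fun i => b (inord i)) => i j k ij jk kn.
have [jn iN] : (j < n.+1)%N /\ (i < n.+1)%N.
  by split; [exact: ltn_trans jk _|exact: ltn_trans ij (ltn_trans jk _)].
by apply: ab; rewrite !inordK.
Qed.

Lemma cvg_gap (F : set_system nat) {FF : ProperFilter F} (f g : nat -> R) (l m e : R) :
  f k @[k --> F] --> l -> g k @[k --> F] --> m ->
  (\forall k \near F, e <= `|f k - g k|) -> e <= `|l - m|.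
Proof. by move=> fl gm; apply: cvgr_to_ge (cvg_norm (cvgB fl gm)). Qed.

(** Forbidden sequences for eps - 2^-m, for every m, would have an ultraproduct
    containing one for eps. *)
Lemma no_long_sequence_open (eps : R) (n : nat) : no_long_sequence T phi eps n ->
  exists2 eps' : R, eps' < eps & no_long_sequence T phi eps' n.
Proof.
move=> /no_long_sequenceP no; apply: contrapT => nex; apply: no.
have pat (m : nat) : exists M, model T M /\ exists a b, @bipattern M (eps - 2 ^- m) n a b.
  apply: contrapT => /no_long_sequenceP no; apply: nex.
  by exists (eps - 2 ^- m) => //; rewrite ltrBlDr ltrDl pow2_gt0.
pose Mk m := projT1 (cid (pat m)).
have MkT m : model T (Mk m) by rewrite /Mk; case: cid => M [].
have /choice_dep [a /choice_dep [b ab]] :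
    forall m, exists a b, @bipattern (Mk m) (eps - 2 ^- m) n a b.
  by move=> m; rewrite /Mk; case: cid => M [].
have [U [UU Uoo [M [TM [a' [b' cv]]]]]] := sequence_compactness a b MkT.
have UF : ProperFilter U := @ultra_proper _ _ UU.
exists M; split => //; exists a', b' => i j k ij jk kn.
apply/ler_addgt0Pr => e e0; rewrite -lerBlDr.
apply: cvg_gap (cv j i) (cv j k) _; have [m me] := pow2_small e0.
apply: Uoo; exists m => // l /= ml; apply: le_trans (ab l i j k ij jk kn).
rewrite lerD2l lerN2; apply: le_trans me.
exact: pow2_anti.
Qed.

(** If there were no bound, compactness would give an infinite sequence with
    phi(a_j, b_i) and phi(a_j, b_k) apart for i < j < k. Taking limits along an
    ultrafilter makes phi(a_j, b_i) and phi(a_i, b_j) almost constant on a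
    subsequence, with distinct limits, which contradicts stability. *)
Lemma no_long_sequence_exists (eps : R) : stable T phi -> 0 < eps ->
  exists n, no_long_sequence T phi eps n.
Proof.
move=> stab e0; apply: contrapT => nex.
have pat (m : nat) : exists M, model T M /\ exists a b, @bipattern M eps m a b.
  by apply: contrapT => /no_long_sequenceP no; apply: nex; exists m.
pose Mk m := projT1 (cid (pat m)).
have MkT m : model T (Mk m) by rewrite /Mk; case: cid => M [].
have /choice_dep [a0 /choice_dep [b0 ab0]] : forall m, exists a b, @bipattern (Mk m) eps m a b.
  by move=> m; rewrite /Mk; case: cid => M [].
have [U [UU Uoo [M [TM [a [b cv]]]]]] := sequence_compactness a0 b0 MkT.
have UF : ProperFilter U := @ultra_proper _ _ UU.
pose f i j := feval phi (vcat (a i) (b j)).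
have f01 i j : 0 <= f i j <= 1 by exact: feval_bounds.
have gap i j k : (i < j)%N -> (j < k)%N -> eps <= `|f j i - f j k|.
  move=> ij jk; apply: cvg_gap (cv j i) (cv j k) _.
  by apply: Uoo; exists k => // m /= km; exact: ab0.
(* s j is the limit of phi(a_j, b_k) in k, and t i that of phi(a_j, b_i) in j. *)
pose s j := ulim U (fun k => f j k); pose t i := ulim U (fun j => f j i).
have s01 j : 0 <= s j <= 1 by exact: ulim_bounds.
have t01 j : 0 <= t j <= 1 by exact: ulim_bounds.
have fs j : f j k @[k --> U] --> s j by exact: ulimP.
have ft i : f j i @[j --> U] --> t i by exact: ulimP.
pose s' := ulim U s; pose t' := ulim U t.
have ss : s j @[j --> U] --> s' by exact: ulimP.
have tt : t j @[j --> U] --> t' by exact: ulimP.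
have gap1 i j : (i < j)%N -> eps <= `|f j i - s j|.
  move=> ij; apply: cvg_gap (cvg_cst _) (fs j) _.
  by apply: Uoo; exists j.+1 => // k /= jk; exact: gap.
have gap2 i : eps <= `|t i - s'|.
  apply: cvg_gap (ft i) ss _.
  by apply: Uoo; exists i.+1 => // j /= ij; exact: gap1.
have gap3 : eps <= `|t' - s'|.
  by apply: cvg_gap tt (cvg_cst _) _; apply: nearW.
(* Each of the two values phi(a_j, b_i), phi(a_i, b_j) will be within
   2 * eps / 8 of the limits t' and s', which leaves a gap of eps / 2. *)
have e8 : 0 < eps / 8 by lra.
have near_lim (h : nat -> R) (l : R) : h k @[k --> U] --> l ->
    U [set k | `|l - h k| < eps / 8].
  by move=> /cvgrPdist_lt /(_ _ e8).
have [x [xP xQ]] := @filter_chain U UF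
  [set n | `|t' - t n| < eps / 8 /\ `|s' - s n| < eps / 8]
  (fun n m => `|t n - f m n| < eps / 8 /\ `|s n - f n m| < eps / 8)
  (filterI (near_lim _ _ tt) (near_lim _ _ ss))
  (fun n _ => filterI (near_lim _ _ (ft n)) (near_lim _ _ (fs n))).
have e2 : 0 < eps / 2 by lra.
apply: (stab _ e2); exists M; split => //; exists (a \o x), (b \o x) => i j ij.
have [h1 h2] := xP i; have [h3 h4] := xQ i j ij.
move: gap3 h1 h2 h3 h4; rewrite -/(f (x i) (x j)) -/(f (x j) (x i)).
rewrite ler_normr !ltr_norml ler_normr.
by move=> /orP[?|?] ? ? ? ?; apply/orP; [right|left]; lra.
Qed.

End Compactness.

(** * Approximating a point of an elementary extension inside M *)

Section Approximation.
Variables (R : realType) (L : signature R) (M : structure L).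

(** One variable for each element of M, so that the parameters of several
    formulae can be named in a common context. *)
Definition diagram_ctx : ctx L := @Ctx L {s : sorts L & M s} (@projT1 _ _).

Definition diagram : valuation M diagram_ctx := fun v => projT2 v.

Definition name_parameters X (psi : pformula M X) :
    formula (cat_ctx X diagram_ctx) :=
  fsubst (fun v : var (cat_ctx X (tuple_ctx (@pf_sort R L M X psi))) =>
    match v return term (cat_ctx X diagram_ctx) (vsort (cat_ctx X _) v) with
    | inl v => Var (cat_ctx X diagram_ctx) (inl v)
    | inr w => Var (cat_ctx X diagram_ctx) (inr (existT _ (pf_sort w) (pf_par w)))
    end) (pf_form psi).

Lemma feval_name_parameters X (psi : pformula M X) (r : extpoint M X) :
  feval (name_parameters psi) (vcat (point_val r) (vmap (point_ext r) diagram)) =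
  pfeval psi r.
Proof.
rewrite feval_subst; congr feval.
by apply: functional_extensionality_dep => -[v|w].
Qed.

Lemma pfeval_bounds X (psi : pformula M X) (r : extpoint M X) : 0 <= pfeval psi r <= 1.
Proof. exact: feval_bounds. Qed.

Lemma feval_bigmax Z (N : structure L) (I : finType) (chi : I -> formula Z)
    (chi0 : formula Z) (a : valuation N Z) :
  feval (\big[@fmax R L Z/chi0]_i chi i) a =
  \big[Num.max/feval chi0 a]_i feval (chi i) a.
Proof. exact: (big_morph (fun theta => feval theta a) (fun f g => feval_max f g a) erefl). Qed.

(** A point of an elementary extension satisfies finitely many approximate
    equations with parameters in M; so the infimum over all tuples of the
    largest error is small in the extension, hence in M. *)
Lemma finitely_approximable (m : nat) (sx : 'I_m -> sorts L) (I : finType)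
    (psi : I -> pformula M (tuple_ctx sx)) (r : extpoint M (tuple_ctx sx)) (e : R) :
  0 < e -> exists c : valuation M (tuple_ctx sx),
    forall i, `|pfeval (psi i) (point_in c) - pfeval (psi i) r| <= e.
Proof.
move=> e0; have e4 : 0 < e / 4 by lra.
have [i0 _|I0] := pickP (@predT I); last first.
  by exists (default_valuation M (tuple_ctx sx)) => i; have := I0 i.
pose Z := cat_ctx (tuple_ctx sx) diagram_ctx.
have ex i := const_formula (name_parameters (psi i)) (pfeval_bounds (psi i) r) e4.
have [k kapprox] := choice ex.
pose chi i := fabsdiff (name_parameters (psi i)) (k i).
pose error := \big[@fmax R L Z/chi i0]_i chi i.
pose xs i : var Z := inl i.
pose d := vcat (default_valuation M (tuple_ctx sx)) diagram.
have small : feval (inf_vars xs (enum 'I_m) error) d <= e / 4.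
  rewrite -(elext_elem (point_ext r)).
  apply: le_trans (inf_vars_le (f := xs) _
    (b := vcat (point_val r) (vmap (point_ext r) diagram)) _) _.
    by move=> [v vI|//]; case: (vI v); rewrite ?mem_enum.
  have chi_small i : feval (chi i) (vcat (point_val r) (vmap (point_ext r) diagram)) <= e / 4.
    by rewrite feval_absdiff feval_name_parameters distrC.
  by rewrite feval_bigmax; apply/bigmax_leP.
have [b db] := inf_vars_approx xs (enum 'I_m) error d e4.
move=> /le_trans/(_ (lerD small (lexx _))).
pose c : valuation M (tuple_ctx sx) := fun v => b (inl v).
have -> : b = vcat c diagram.
  by apply: functional_extensionality_dep => -[//|v]; rewrite -db.
rewrite feval_bigmax => /bigmax_leP [_ chi_le]; exists c => i.
have := chi_le i isT; rewrite feval_absdiff.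
have -> : feval (name_parameters (psi i)) (vcat c diagram) =
    pfeval (psi i) (point_in c) by exact: (feval_name_parameters (psi i) (point_in c)).
have := kapprox i M (vcat c diagram).
by rewrite !ler_norml; lra.
Qed.

End Approximation.

(** * Uniform approximation by finitely many functions *)

Lemma sorted_enum_set K (W : {set 'I_K}) : sorted ltn (map val (enum W)).
Proof.
rewrite -[enum _](eq_filter (mem_enum _)) -(eq_filter (mem_map val_inj _)) -filter_map.
by rewrite (sorted_filter ltn_trans) // -enumT val_enum_ord iota_ltn_sorted.
Qed.

Section FarPattern.
Variables (R : realType) (A B : Type) (f : A -> B -> R) (g : B -> R).
Hypothesis g01 : forall b, 0 <= g b <= 1.
Hypothesis g_approx : forall (I : finType) (b : I -> B) (e : R), 0 < e ->
  exists a, forall i, `|f a (b i) - g (b i)| <= e.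

(** Errors in the two directions are handled together: the sign true exchanges
    overestimates and underestimates. *)
Definition sg (s : bool) (x : R) : R := if s then - x else x.

Lemma near_minimiser (d : R) : 0 < d -> forall b0 : B, exists nm : bool -> set B -> B,
  forall s (S : set B) b, S b -> S (nm s S) /\ sg s (g (nm s S)) <= sg s (g b) + d.
Proof.
move=> d0 b0; suff ex (sS : bool * set B) : exists b', forall b, sS.2 b ->
    sS.2 b' /\ sg sS.1 (g b') <= sg sS.1 (g b) + d.
  have [nm nmP] := choice ex; exists (fun s S => nm (s, S)) => s S b Sb.
  exact: (nmP (s, S) b Sb).
case: sS => s S /=; have [[b1 Sb1]|nex] := pselect (exists b, S b); last first.
  by exists b0 => b Sb; case: nex; exists b.
have lb : lbound [set sg s (g b) | b in S] (-1).
  by move=> _ [b _ <-]; case: s; have := g01 b => /=; lra.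
have [|_ [b' Sb' <-] b'inf] := @inf_adherent _ [set sg s (g b) | b in S] _ d0.
  by split; [exists (sg s (g b1)), b1|exists (-1)].
exists b' => b Sb; split => //; apply: le_trans (ltW b'inf) _.
by rewrite lerD2r; apply: ge_inf; [exists (-1)|exists b].
Qed.

Section Sequence.
Variables (K : nat) (e d : R).
Hypothesis d0 : 0 < d.
Implicit Types (c : 'I_K -> A) (W : {set 'I_K}).

Definition far s W c : set B :=
  [set b | forall i, i \in W -> sg s (g b) + e < sg s (f (c i) b)].

Lemma eq_far s W c c' : (forall i, i \in W -> c i = c' i) -> far s W c = far s W c'.
Proof.
by move=> cc'; apply/seteqP; split => b bW i iW; have := bW i iW; rewrite cc'.
Qed.

Lemma sub_far s W W' c : W \subset W' -> far s W' c `<=` far s W c.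
Proof. by move=> /fintype.subsetP WW' b bW' i /WW'; exact: bW'. Qed.

(** The n-th point is chosen to agree with g up to d at one near minimiser of
    each of the sets far s W with W among the earlier indices. *)
Lemma far_sequence (nm : bool -> set B -> B) : exists c : 'I_K -> A,
  forall (i : 'I_K) s W, (forall j, j \in W -> (j < i)%N) ->
    `|f (c i) (nm s (far s W c)) - g (nm s (far s W c))| <= d.
Proof.
have [a0 _] := g_approx (fun v : void => match v with end) d0.
suff /(_ K) [c cP] : forall n, exists c : 'I_K -> A,
    forall (i : 'I_K) s W, (i < n)%N -> (forall j, j \in W -> (j < i)%N) ->
    `|f (c i) (nm s (far s W c)) - g (nm s (far s W c))| <= d.
  by exists c => i s W; exact: cP.
elim=> [|n [c cP]]; first by exists (fun=> a0).
have [a aP] := g_approx (fun sW : bool * {set 'I_K} => nm sW.1 (far sW.1 sW.2 c)) d0.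
exists (fun i : 'I_K => if i == n :> nat then a else c i) => i s W.
rewrite ltnS leq_eqVlt => /orP iln Wi.
rewrite -(@eq_far s W c); last first.
  move=> j /Wi ji; case: eqP => // jn; move: ji iln; rewrite jn => ni.
  by case=> [/eqP ni'|/ltnW]; [rewrite ni' ltnn in ni|rewrite leqNgt ni].
case: eqP => [_|/eqP ni]; first exact: (aP (s, W)).
by apply: cP => //; case: iln => //; rewrite (negbTE ni).
Qed.

(** If many points of the sequence overestimate g by more than e at a single b,
    list these points as c_0, c_1, ... and let b_k be a near minimiser of g
    among the elements at which the first k of them overestimate g. Since g(b_k)
    increases with k, up to d, the value f(c_j, b_k) > g(b_k) + e for j < k
    exceeds by e - 2d the value f(c_j, b_i), which for i < j is close to g(b_i),
    because c_j was chosen after b_i was prepared. Without the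
    minimisation, g(b_i) and g(b_k) could not be compared. Underestimates are
    treated in the same way with the signs reversed. *)
Lemma far_pattern : exists c : 'I_K -> A, forall s W b,
  far s W c b -> exists (x : nat -> A) (y : nat -> B), forall i j k,
    (i < j)%N -> (j < k)%N -> (k <= #|W|)%N ->
    e - 2 * d <= `|f (x j) (y i) - f (x j) (y k)|.
Proof.
have [[b0 _]|nB] := pselect (exists b : B, True); last first.
  have [a0 _] := g_approx (fun v : void => match v with end) d0.
  by exists (fun=> a0) => s W b; case: nB; exists b.
have [nm nmP] := near_minimiser d0 b0.
have [c cP] := far_sequence nm; exists c => s W b Wb.
have [->|[i0 i0W]] := set_0Vmem W.
  have [a0 _] := g_approx (fun v : void => match v with end) d0.
  by exists (fun=> a0), (fun=> b0) => i j k ij jk; rewrite cards0 leqNgt (leq_trans _ jk).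
pose w k := [set i in W | (index i (enum W) < k)%N].
pose y k := nm s (far s (w k) c).
exists (fun j => c (nth i0 (enum W) j)), y => i j k ij jk kW.
set cj := nth i0 (enum W) j.
have jW : (j < size (enum W))%N by rewrite -cardE; exact: leq_trans jk kW.
have cjW : cj \in W by rewrite -mem_enum mem_nth.
have idx : index cj (enum W) = j by rewrite index_uniq // enum_uniq.
have sub k' : w k' \subset W by apply/fintype.subsetP => l; rewrite inE => /andP[].
have fark k' : far s (w k') c (y k').
  by case: (nmP s (far s (w k') c) b) => //; apply: sub_far Wb; exact: sub.
have far_j : sg s (g (y k)) + e < sg s (f (c cj) (y k)).
  by apply: fark; rewrite inE cjW idx.
have near_i : `|f (c cj) (y i) - g (y i)| <= d.
  apply: cP => l; rewrite inE => /andP[lW li].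
  have srt : sorted (fun u v : 'I_K => (u < v)%N) (enum W).
    by have := sorted_enum_set W; rewrite sorted_map.
  apply: (sorted_ltn_index _ srt); rewrite ?mem_enum // ?idx.
    by move=> ? ? ?; exact: ltn_trans.
  exact: ltn_trans li ij.
have mono : sg s (g (y i)) <= sg s (g (y k)) + d.
  case: (nmP s (far s (w i) c) (y k)) => //; apply: sub_far (fark k).
  apply/fintype.subsetP => l; rewrite !inE => /andP[-> /ltn_trans -> //].
  exact: ltn_trans jk.
move: far_j near_i mono; rewrite ler_norml ler_normr => far_j /andP[? ?] mono.
clearbody y; clear Wb fark.
by apply/orP; case: s far_j mono => /= ? ?; [left|right]; lra.
Qed.

End Sequence.
End FarPattern.

(** * Medians *)

Section Median.
Variables (R : realType) (n : nat).
Implicit Types t : 'I_(2 * n).-1 -> R.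

Lemma subset_of_card (T : finType) (H : {set T}) k : (k <= #|H|)%N ->
  exists2 W : {set T}, W \subset H & #|W| = k.
Proof.
move=> kH; exists [set x in take k (enum H)].
  by apply/fintype.subsetP => x; rewrite inE => /mem_take; rewrite mem_enum.
rewrite cardsE (card_uniqP _) ?take_uniq ?enum_uniq // size_takel //.
by rewrite -cardE.
Qed.

(** Otherwise n of the 2n - 1 values would be at most v, and these n indices
    would bound the median by v. *)
Lemma gt_med t (v : R) : 0 <= v -> v < med t ->
  exists2 W : {set 'I_(2 * n).-1}, #|W| = n & forall i, i \in W -> v < t i.
Proof.
move=> v0 vt; pose H := [set i | v < t i]%SET.
have [nH|Hn] := leqP n #|H|.
  have [W /fintype.subsetP WH Wn] := subset_of_card nH.
  by exists W => // i /WH; rewrite inE.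
have [|W /fintype.subsetP WH Wn] := @subset_of_card _ (~: H) n.
  by have := cardsC H; rewrite card_ord; lia.
move: vt; rewrite ltNge => /negP []; apply/bigmin_leP; right.
exists W; first exact/eqP.
by apply/bigmax_leP; split => // i /WH; rewrite !inE -leNgt.
Qed.

Lemma lt_med t (v : R) : v <= 1 -> med t < v ->
  exists2 W : {set 'I_(2 * n).-1}, #|W| = n & forall i, i \in W -> t i < v.
Proof.
move=> v1 /bigmin_ltP [|[W /eqP Wn tW]]; first by rewrite ltNge v1.
exists W => // i iW; apply: le_lt_trans tW; exact: le_bigmax_cond.
Qed.

Lemma med_bounds t : (forall i, 0 <= t i <= 1) -> 0 <= med t <= 1.
Proof.
move=> t01; apply/andP; split; last exact: bigmin_le_id.
by apply: le_bigmin => // W _; exact: bigmax_ge_id.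
Qed.

End Median.

(** * Medians and forced limits are Lipschitz *)

Section Lipschitz.
Variable R : realType.

Lemma max_lipschitz (x y x' y' e : R) : `|x - x'| <= e -> `|y - y'| <= e ->
  `|Num.max x y - Num.max x' y'| <= e.
Proof.
rewrite !ler_norml => /andP[? ?] /andP[? ?].
by case: (leP x y) => ?; case: (leP x' y') => ?; lra.
Qed.

Lemma min_lipschitz (x y x' y' e : R) : `|x - x'| <= e -> `|y - y'| <= e ->
  `|Num.min x y - Num.min x' y'| <= e.
Proof.
rewrite !ler_norml => /andP[? ?] /andP[? ?].
by case: (leP x y) => ?; case: (leP x' y') => ?; lra.
Qed.

Lemma med_lipschitz n (t t' : 'I_(2 * n).-1 -> R) (e : R) : 0 <= e ->
  (forall i, `|t i - t' i| <= e) -> `|med t - med t'| <= e.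
Proof.
move=> e0; suff half (u u' : 'I_(2 * n).-1 -> R) :
    (forall i, `|u i - u' i| <= e) -> med u - med u' <= e.
  move=> tt'; rewrite ler_norml lerNl opprB !half // => i.
  by rewrite distrC.
move=> uu'; rewrite lerBlDl.
have : med u' <= med u' by [].
move=> /bigmin_leP [le1|[W Wn /bigmax_leP [ge0 Wle]]].
  apply: le_trans (bigmin_le_id _ _ _ _) (le_trans le1 _); by rewrite lerDl.
apply/bigmin_leP; right; exists W => //; apply/bigmax_leP; split; first exact: addr_ge0.
move=> i iW; have := uu' i; rewrite ler_norml => /andP[_].
by have := Wle i iW; rewrite -/(med u'); lra.
Qed.

End Lipschitz.

Section ForcedLimit.
Variable R : realType.
Implicit Types a : nat -> R.

Lemma fseq_lipschitz a a' n (e : R) : (forall k, (k <= n)%N -> `|a k - a' k| <= e) ->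
  `|fseq a n - fseq a' n| <= e.
Proof.
elim: n => [|n IH] aa' /=; first exact: aa'.
have {}IH : `|fseq a n - fseq a' n| <= e by apply: IH => k kn; apply: aa'; exact: leqW.
apply: max_lipschitz; first by rewrite opprD addrACA subrr addr0.
by apply: min_lipschitz; [rewrite opprD addrACA subrr addr0|exact: aa'].
Qed.

Lemma fseq_step a n : `|fseq a n.+1 - fseq a n| <= 2 ^- n.+1.
Proof.
have p0 := pow2_gt0 R n.+1.
have [|/andP[? ?] _] := @clamp_closest R (fseq a n - 2 ^- n.+1) (fseq a n + 2 ^- n.+1) (a n.+1).
  by lra.
by rewrite ler_norml /=; lra.
Qed.

(** When the step towards a_(n+1) is cut short, it has length 2^-(n+1) and ends
    between the previous term and a_(n+1): on one side the error bound 2^-n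
    shrinks by the length of the step, on the other the error is at most that
    of a_(n+1). *)
Lemma fseq_close a (l : R) : (forall n, `|a n - l| <= 2 ^- n) ->
  forall n, `|fseq a n - l| <= 2 ^- n.
Proof.
move=> al; elim=> [|n IH]; first exact: al.
have := al n.+1; move: IH; rewrite pow2_half !ler_norml => /andP[? ?] /andP[? ?].
rewrite /= /clamp pow2_half; have := pow2_gt0 R n => ?.
by case: (leP (fseq a n + 2 ^- n / 2) (a n.+1)) => ?;
  case: (leP (fseq a n - 2 ^- n / 2) _) => ?; lra.
Qed.

Lemma fseq_bounds a : (forall n, 0 <= a n <= 1) -> forall n, 0 <= fseq a n <= 1.
Proof.
move=> a01; elim=> [|n /andP[? ?]]; first exact: a01.
have /andP[? ?] := a01 n.+1; have ? := pow2_gt0 R n.+1.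
rewrite /= /clamp.
by case: (leP (fseq a n + 2 ^- n.+1) (a n.+1)) => ?;
  case: (leP (fseq a n - 2 ^- n.+1) _) => ?; lra.
Qed.

Lemma fseq_cauchy a n k : `|fseq a (n + k) - fseq a n| <= 2 ^- n - 2 ^- (n + k).
Proof.
elim: k => [|k]; first by rewrite addn0 !subrr normr0.
rewrite addnS; have := fseq_step a (n + k); rewrite pow2_half !ler_norml.
by move=> /andP[? ?] /andP[? ?]; lra.
Qed.

Lemma pow2_cvg : (2 ^- n : R) @[n --> \oo] --> 0.
Proof.
apply/cvgr0Pnorm_le => e /pow2_small [n ne]; exists n => // m /= nm.
rewrite gtr0_norm ?pow2_gt0 //; apply: le_trans ne.
exact: pow2_anti.
Qed.

(** Adding 2^-n to the constrained sequence makes it nonincreasing. *)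
Lemma fseq_cvg a : fseq a n @[n --> \oo] --> flim a.
Proof.
suff cv : cvgn (fun n => fseq a n + 2 ^- n).
  have : cvgn (fun n => (fseq a n + 2 ^- n) - 2 ^- n).
    by apply: is_cvgB => //; apply: cvgP pow2_cvg.
  by under eq_fun do rewrite addrK.
apply: nonincreasing_is_cvgn.
  apply/nonincreasing_seqP => n; have := fseq_step a n.
  by rewrite pow2_half ler_norml => /andP[? ?]; lra.
exists (fseq a 0 - 1) => _ [n _ <-].
have := fseq_cauchy a 0 n; rewrite add0n expr0 invr1 ler_norml => /andP[? ?].
by have := pow2_gt0 R n; lra.
Qed.

Lemma fseq_flim a n : `|fseq a n - flim a| <= 2 ^- n.
Proof.
rewrite distrC; apply: cvgr_to_le (cvg_norm (cvgB (@fseq_cvg a) (cvg_cst (fseq a n)))) _.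
exists n => // m /= nm; have := fseq_cauchy a n (m - n).
rewrite subnKC //; have := pow2_gt0 R m; rewrite /cst; lra.
Qed.

Lemma flim_close a (l : R) : (forall n, `|a n - l| <= 2 ^- n) -> flim a = l.
Proof.
move=> /fseq_close al; apply: (cvg_unique _ (@fseq_cvg a)) => //.
apply/cvgrPdist_le => e /pow2_small [n ne]; exists n => // m /= nm.
rewrite distrC; apply: le_trans (al m) _; apply: le_trans ne.
exact: pow2_anti.
Qed.

Lemma flim_bounds a : (forall n, 0 <= a n <= 1) -> 0 <= flim a <= 1.
Proof.
move=> /fseq_bounds a01; apply/andP; split.
  by apply: cvgr_to_ge (@fseq_cvg a) _; apply: nearW => n; case/andP: (a01 n).
by apply: cvgr_to_le (@fseq_cvg a) _; apply: nearW => n; case/andP: (a01 n).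
Qed.

Lemma flim_lipschitz a a' n (e : R) : (forall k, (k <= n)%N -> `|a k - a' k| <= e) ->
  `|flim a - flim a'| <= e + 2 * 2 ^- n.
Proof.
move=> /fseq_lipschitz; have := fseq_flim a n; have := fseq_flim a' n.
by rewrite !ler_norml => /andP[? ?] /andP[? ?] /andP[? ?]; lra.
Qed.

End ForcedLimit.

(** * Types over M *)

Section Types.
Variables (R : realType) (L : signature R) (M : structure L).

(** Conditions only say which formulae vanish; two different values of psi are
    told apart by subtracting from psi a constant lying between them. *)
Lemma pfeval_determined X (psi : pformula M X) (r r' : extpoint M X) :
  conditions_of r = conditions_of r' -> pfeval psi r = pfeval psi r'.
Proof.
suff le_val (r1 r2 : extpoint M X) :
    conditions_of r1 = conditions_of r2 -> pfeval psi r2 <= pfeval psi r1.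
  by move=> rr'; apply/eqP; rewrite eq_le !le_val.
move=> r12; rewrite leNgt; apply/negP => lt_val.
pose t := (pfeval psi r1 + pfeval psi r2) / 2.
have /andP[? ?] := pfeval_bounds psi r1; have /andP[? ?] := pfeval_bounds psi r2.
have t01 : 0 <= t <= 1 by rewrite /t; lra.
have e0 : 0 < (pfeval psi r2 - pfeval psi r1) / 4 by lra.
have [k kt] := const_formula (pf_form psi) t01 e0.
pose chi := PFormula (Monus (pf_form psi) k) (@pf_par R L M X psi).
have chiE r0 : pfeval chi r0 = Num.max (pfeval psi r0 -
  feval k (vcat (point_val r0) (vmap (point_ext r0) (@pf_par R L M X psi)))) 0 by [].
have : conditions_of r1 chi.
  rewrite /conditions_of /= chiE; apply: max_r.
  have := kt _ (vcat (point_val r1) (vmap (point_ext r1) (@pf_par R L M X psi))).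
  by rewrite /t ler_norml => /andP[? ?]; lra.
rewrite r12 /conditions_of /= chiE => /eqP; rewrite eq_le ge_max => /andP[/andP[h _] _].
move: h; have := kt _ (vcat (point_val r2) (vmap (point_ext r2) (@pf_par R L M X psi))).
by rewrite /t ler_norml => /andP[? ?]; lra.
Qed.

Lemma typeval_tp X (psi : pformula M X) (r : extpoint M X) :
  typeval psi (tp r) = pfeval psi r.
Proof.
apply: pfeval_determined; rewrite /realisation; case: cid => r' /= <-.
by [].
Qed.

Lemma typeval_bounds X (psi : pformula M X) (q : stype M X) : 0 <= typeval psi q <= 1.
Proof. exact: pfeval_bounds. Qed.

Lemma typeval_continuous X (psi : pformula M X) : continuous (typeval psi : stype M X -> R).
Proof.
move=> q.
have /(cvg_sup (fun psi : pformula M X =>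
  Topological.class (initial_topology (typeval psi)))) /(_ psi) cvq : nbhs q --> q by [].
apply: cvg_trans; last first.
  exact: (@initial_continuous _ _ (typeval psi) q).
by move=> V; exact: cvq.
Qed.

(** The filter is generated by the sets of tuples of M imitating q on finitely
    many formulae; they are nonempty by finite approximability. *)
Lemma types_in_model_dense n (sy : 'I_n -> sorts L) (q : stype M (tuple_ctx sy)) :
  exists F : set_system (valuation M (tuple_ctx sy)), ProperFilter F /\
    tp (point_in b) @[b --> F] --> q.
Proof.
pose near_set (I : finType) (psi : I -> pformula M (tuple_ctx sy)) (e : R) :=
  [set b | forall i, `|pfeval (psi i) (point_in b) - typeval (psi i) q| <= e].
pose F : set_system (valuation M (tuple_ctx sy)) := [set A |
  exists (I : finType) (psi : I -> pformula M (tuple_ctx sy)) (e : R),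
  0 < e /\ near_set I psi e `<=` A].
have FF : ProperFilter F.
  split; first last.
    split.
    - by exists void, (fun v : void => match v with end), 1; split.
    - move=> A B [I [psi [e [e0 IA]]]] [J [chi [e' [e'0 JB]]]].
      exists (I + J)%type, (fun k => match k with inl i => psi i | inr j => chi j end).
      exists (Num.min e e').
      split; first by rewrite lt_min e0.
      move=> b bIJ; split.
        by apply: IA => i; apply: le_trans (bIJ (inl i)) _; rewrite ge_min lexx.
      by apply: JB => j; apply: le_trans (bIJ (inr j)) _; rewrite ge_min lexx orbT.
    - move=> A B AB [I [psi [e [e0 IA]]]]; exists I, psi, e; split => //.
      exact: subset_trans AB.
  move=> [I [psi [e [e0 IA]]]].
  by have [b bP] := finitely_approximable psi (realisation q) e0; exact: (IA b).
exists F; split => //.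
apply/cvg_sup => psi V [_ [[W oW <-] Wq]] /filterS; apply.
have /nbhs_ballP [e /= e0 eW] : nbhs (typeval psi q) W by apply: open_nbhs_nbhs.
have e2 : 0 < e / 2 by lra.
exists unit, (fun=> psi), (e / 2); split => // b /(_ tt) b_near.
apply: eW; rewrite /ball /= typeval_tp distrC; apply: le_lt_trans b_near _; lra.
Qed.

End Types.

(** * The definition of a phi-type *)

Section Definability.
Variables (R : realType) (L : signature R) (T : theory L) (m n : nat).
Variables (sx : 'I_m -> sorts L) (sy : 'I_n -> sorts L).
Local Notation X := (tuple_ctx sx).
Local Notation Y := (tuple_ctx sy).
Variables (phi : formula (cat_ctx X Y)) (M : structure L).
Hypotheses (phi_stable : stable T phi) (M_model : model T M).

Lemma NboundP (e : R) : 0 < e -> no_long_sequence T phi e (Nbound T phi e).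
Proof.
move=> e0; have [k0 k0P] := no_long_sequence_exists phi_stable e0.
have ex : exists k, `[< no_long_sequence T phi e k >] by exists k0; apply/asboolP.
have [|//] := @xgetPex _ 0%N [set k | no_long_sequence T phi e k /\
  forall k', no_long_sequence T phi e k' -> (k <= k')%N].
case: (ex_minnP ex) => k /asboolP kP kmin; exists k; split => // k' k'P.
by apply: kmin; apply/asboolP.
Qed.

(** The functions phi(c, -) on M approximate the values of p on finite sets, so
    far_pattern applies; the loss of 2d is paid by passing from e to e'. *)
Lemma median_approximation (p : phitype phi M) (e : R) : 0 < e ->
  exists c : 'I_(2 * Nbound T phi e).-1 -> valuation M X,
    forall b : valuation M Y, `|deps (T := T) (phi := phi) b c - phival p b| <= e.
Proof.
move=> e0; have [e' e'e no_e'] := no_long_sequence_open (NboundP e0).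
have d0 : 0 < (e - e') / 2 by lra.
pose f (a : valuation M X) (b : valuation M Y) := feval phi (vcat a b).
have g01 b : 0 <= phival p b <= 1 by exact: pfeval_bounds.
have approx (I : finType) (b : I -> valuation M Y) (d : R) : 0 < d ->
    exists a, forall i, `|f a (b i) - phival p (b i)| <= d.
  exact: (finitely_approximable (fun i => PFormula phi (b i)) (realisation (repr p))).
have [c cP] := far_pattern g01 approx (2 * Nbound T phi e).-1 e d0.
have no_far s (W : {set 'I_(2 * Nbound T phi e).-1}) b : #|W| = Nbound T phi e ->
    ~ far f (phival p) e s W c b.
  move=> WN /cP [x [y xy]]; move/no_long_sequenceP: no_e'; apply.
  exists M; split => //; exists x, y => i j k ij jk kN.
  by have := xy i j k ij jk; rewrite WN => /(_ kN); rewrite /f; lra.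
exists c => b; have /andP[? ?] := g01 b; rewrite ler_norml; apply/andP; split.
  rewrite leNgt; apply/negP => lt_e.
  have [||W WN Wb] := @lt_med _ _ (fun i => f (c i) b) (phival p b - e); [lra| |].
    by move: lt_e; rewrite /deps /f; lra.
  by apply: (no_far true W b WN) => i /Wb /=; lra.
rewrite leNgt; apply/negP => gt_e.
have [||W WN Wb] := @gt_med _ _ (fun i => f (c i) b) (phival p b + e); [lra| |].
  by move: gt_e; rewrite /deps /f; lra.
by apply: (no_far false W b WN) => i /Wb /=; lra.
Qed.

Lemma feval_tilde (N : structure L) (a : valuation N X) (b : valuation N Y) :
  feval (tilde phi) (vcat b a) = feval phi (vcat a b).
Proof.
by rewrite feval_subst; congr feval; apply: functional_extensionality_dep => -[v|w].
Qed.

(** The predicate d phi(y, C), written with instances of tilde phi so that it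
    visibly depends on the tilde phi-type of y only. *)
Definition dphi_type (C : dparams T phi M) (q : stype M Y) : R :=
  flim (fun k => med (fun i => typeval (PFormula (tilde phi) (C k i)) q)).

Lemma dphi_typeE (C : dparams T phi M) (r : extpoint M Y) :
  dphi (point_val r) (fun k i => vmap (point_ext r) (C k i)) = dphi_type C (tp r).
Proof.
congr flim; apply/funext => k; congr med; apply/funext => i.
by rewrite typeval_tp /pfeval feval_tilde.
Qed.

Lemma dphi_type_bounds (C : dparams T phi M) (q : stype M Y) : 0 <= dphi_type C q <= 1.
Proof. by apply: flim_bounds => k; apply: med_bounds => i; exact: typeval_bounds. Qed.

Lemma dphi_type_continuous (C : dparams T phi M) : continuous (dphi_type C).
Proof.
move=> q; have FF : Filter (nbhs q) := nbhs_filter q.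
apply/(cvgrPdist_le (F := nbhs q)) => e e0.
have [|k ke] := @pow2_small R (e / 4); first by lra.
have e2 : 0 < e / 2 by lra.
have : \forall q' \near q, forall (j : 'I_k.+1) i,
    `|typeval (PFormula (tilde phi) (C j i)) q -
      typeval (PFormula (tilde phi) (C j i)) q'| <= e / 2.
  apply: (@filter_forall _ _ _ (nbhs q) FF) => j; apply: (@filter_forall _ _ _ (nbhs q) FF) => i.
  have cv : typeval (PFormula (tilde phi) (C j i)) q' @[q' --> q] -->
      typeval (PFormula (tilde phi) (C j i)) q by exact: typeval_continuous.
  by move/(cvgrPdist_le (F := nbhs q)): cv; exact.
apply: filterS => q' qq'; apply: le_trans (flim_lipschitz (n := k) (e := e / 2) _) _.
  move=> j jk; apply: med_lipschitz; first exact: ltW.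
  by move=> i; exact: (qq' (Ordinal (jk : (j < k.+1)%N)) i).
lra.
Qed.

Lemma dphi_type_phi_eqv (C : dparams T phi M) (q q' : stype M Y) :
  phi_eqv (tilde phi) q q' -> dphi_type C q = dphi_type C q'.
Proof.
move=> /asboolP qq'; congr flim; apply/funext => k; congr med; apply/funext => i.
exact: qq'.
Qed.

Lemma dphi_type_tilde (C : dparams T phi M) : tilde_predicate phi (dphi_type C).
Proof.
exists (dphi_type C \o repr); split => [|q|q].
- apply: repr_comp_continuous; first exact: dphi_type_continuous.
  by move=> q q' /eqP /eqmodP /dphi_type_phi_eqv ->.
- exact: dphi_type_bounds.
- apply: dphi_type_phi_eqv; apply/eqmodP.
  by rewrite /phitype_of reprK.
Qed.

Lemma definition_unique (p : phitype phi M) (psi psi' : stype M Y -> R) :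
  is_definition p psi -> is_definition p psi' -> psi = psi'.
Proof.
move=> [[cpsi _] dpsi] [[cpsi' _] dpsi']; apply/funext => q.
have [F [FF Fq]] := types_in_model_dense q.
apply: (cvg_unique _ (cvg_comp _ _ Fq (cpsi q))) => //.
have -> : psi \o (fun b => tp (point_in b)) = psi' \o (fun b => tp (point_in b)).
  by apply/funext => b /=; rewrite -dpsi -dpsi'.
exact: (cvg_comp _ _ Fq (cpsi' q)).
Qed.

End Definability.

Theorem proposition7p6 (R : realType) (L : signature R) (T : theory L)
    (m n : nat) (sx : 'I_m -> sorts L) (sy : 'I_n -> sorts L)
    (phi : formula (cat_ctx (tuple_ctx sx) (tuple_ctx sy)))
    (phi_stable : stable T phi)
    (M : structure L) (M_model : model T M) (p : phitype phi M) :
  exists (C : dparams T phi M) (psi : stype M (tuple_ctx sy) -> R),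
    [/\ unique (is_definition p) psi,
        forall r : extpoint M (tuple_ctx sy),
          dphi (point_val r) (fun k i => vmap (point_ext r) (C k i))
          = psi (tp r)
      & tilde_predicate phi psi].
Proof.
pose C : dparams T phi M := fun k =>
  projT1 (cid (median_approximation phi_stable M_model p (pow2_gt0 R k))).
have CP k b : `|deps (T := T) (phi := phi) b (C k) - phival p b| <= 2 ^- k.
  by rewrite /C; case: cid => c /=.
have def : is_definition p (dphi_type C).
  split; first by split; [exact: dphi_type_continuous|exact: dphi_type_bounds].
  move=> b; rewrite -dphi_typeE; apply/esym; exact: flim_close.
exists C, (dphi_type C); split; last exact: dphi_type_tilde.
  by split=> // psi'; exact: definition_unique.
exact: dphi_typeE.
Qed.
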